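(* Let $C>0$ be a constant, $z=x+iy$, $r=|z|=\sqrt{x^2+y^2}$, and put $$\gamma=i(x^2-y^2),\qquad \delta=-y\left(\frac{y^2}{3}-x^2-1\right)-i\left[x\left(1+y^2-\frac{x^2}{3}\right)-(C-t)\right].$$ Define functions of $(x,y,t)\in\mathbb{R}^3$ by $$\widetilde U=-i\,\frac{|z|^2\bar\gamma+\gamma+\delta z-\bar\delta\bar z}{|\gamma|^2+|\delta|^2},$$ $$\widetilde V=\frac{\left(z(\bar\gamma-\gamma)-\delta z^2-\bar\delta\right)^2}{(|\gamma|^2+|\delta|^2)^2}+\frac{2\widetilde U}{1+|z|^2}+2\,\frac{i\bar z\left(z(\bar\gamma-\gamma)-\delta z^2-\bar\delta\right)}{(|\gamma|^2+|\delta|^2)(1+|z|^2)} .$$ Then: 1. $\widetilde U$ and $\widetilde V$ satisfy the modified Novikov--Veselov equation (at all points $(x,y,t)\neq(0,0,C)$) $$\widetilde U_t=\left(\widetilde U_{zzz}+3\widetilde U_z\widetilde V+\tfrac32\widetilde U\widetilde V_z\right)+\left(\widetilde U_{\bar z\bar z\bar z}+3\widetilde U_{\bar z}\overline{\widetilde V}+\tfrac32\widetilde U\,\overline{\widetilde V}_{\bar z}\right),\qquad \widetilde V_{\bar z}=(\widetilde U^2)_z .$$ 2. For every fixed $t$ they decay at least quadratically in $r$: $\widetilde U=O(r^{-2})$ and $\widetilde V=O(r^{-2})$ as $r\to\infty$. 3. They are real-analytic for $t\neq C$. 4. They have singularities exactly at the point $x=y=0$, $t=C$ (that is, they are real-analytic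 near every other point of $\mathbb{R}^3$, and neither extends continuously to this point). At this point $\widetilde U$ is not defined, and for every fixed $\varphi$, with $z=re^{i\varphi}$, $$\lim_{r\to0,\ \varphi=\mathrm{const}}\widetilde U(z,\bar z,C)=-\cos2\varphi .$$ 5. $$\int_{\mathbb{R}^2}|\widetilde U|^2\,dx\,dy=\begin{cases}3\pi&\text{for }t\neq C,\\ 2\pi&\text{for }t=C.\end{cases}$$
   Context: Subscripts denote partial derivatives, with $\partial_z=\frac12(\partial_x-i\partial_y)$ and $\partial_{\bar z}=\frac12(\partial_x+i\partial_y)$; a bar denotes complex conjugation, and $\overline{\widetilde V}_{\bar z}$ means $\partial_{\bar z}(\overline{\widetilde V})$. *)

(* Defs.v *)
From HB Require Import structures.
From mathcomp Require Import all_boot all_order all_algebra.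
From mathcomp Require Import complex.
From mathcomp Require Import all_classical all_reals all_analysis.

Set Implicit Arguments.
Unset Strict Implicit.
Unset Printing Implicit Defensive.

Import Order.TTheory GRing.Theory Num.Theory.
Import numFieldNormedType.Exports.
Local Open Scope classical_set_scope.
Local Open Scope ring_scope.
Local Open Scope complex_scope.

(* 'i and ^* below elaborate to the numClosedFieldType operations of R[i]; they
   are convertible to Complex 0 1 and to conjc. *)

(* A point of space-time is a triple ((x, y), t) : R * R * R. *)
Definition ex {R : realType} : R * R * R := (1, 0, 0).
Definition ey {R : realType} : R * R * R := (0, 1, 0).
Definition et {R : realType} : R * R * R := (0, 0, 1).

(* R[i] is not a normed module over R in the libraries, so differentiation in
   real directions is componentwise. *)
Definition partial (R : realType) (v : R * R * R) (f : R * R * R -> R[i])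
    (p : R * R * R) : R[i] :=
  'D_v (fun q => complex.Re (f q)) p +i* 'D_v (fun q => complex.Im (f q)) p.

Definition dz (R : realType) (f : R * R * R -> R[i]) (p : R * R * R) : R[i] :=
  2^-1 * (partial ex f p - 'i * partial ey f p).

Definition dzbar (R : realType) (f : R * R * R -> R[i]) (p : R * R * R) :
    R[i] :=
  2^-1 * (partial ex f p + 'i * partial ey f p).

Definition dt (R : realType) (f : R * R * R -> R[i]) : R * R * R -> R[i] :=
  partial et f.

Definition mNV_at (R : realType) (U V : R * R * R -> R[i]) (p : R * R * R) :
    Prop :=
  dt U p =
    (dz (dz (dz U)) p + 3 * dz U p * V p + 3 / 2 * U p * dz V p)
    + (dzbar (dzbar (dzbar U)) p + 3 * dzbar U p * (V p)^*
       + 3 / 2 * U p * dzbar (fun q => (V q)^*) p)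
  /\ dzbar V p = dz (fun q => U q ^+ 2) p.

(* f is of class C^k on the open set A.  This is needed because 'D_v f p is a
   total function, without meaning when f is not derivable. *)
Fixpoint class_C (R : realType) (k : nat) (A : set (R * R * R))
    (f : R * R * R -> R) : Prop :=
  (forall p, A p -> {for p, continuous f}) /\
  if k is k'.+1 then
    forall v : R * R * R,
      (forall p, A p -> derivable f p v) /\
      class_C k' A (fun p => 'D_v f p)
  else True.

Definition class_Cc (R : realType) (k : nat) (A : set (R * R * R))
    (f : R * R * R -> R[i]) : Prop :=
  class_C k A (fun q => complex.Re (f q)) /\ class_C k A (fun q => complex.Im (f q)).

(* Classical solution on the open set A. *)
Definition mNV_solution (R : realType) (A : set (R * R * R))
    (U V : R * R * R -> R[i]) : Prop :=
  [/\ class_Cc 3 A U, class_Cc 1 A V & forall p, A p -> mNV_at U V p].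

Definition power_term (R : realType) (a : nat -> nat -> nat -> R)
    (h : R * R * R) (i j k : nat) : R :=
  a i j k * h.1.1 ^+ i * h.1.2 ^+ j * h.2 ^+ k.

(* The power series converges absolutely, so summing it along cubes is only a
   choice of exhaustion of the index set. *)
Definition analytic_at (R : realType) (f : R * R * R -> R) (p : R * R * R) :
    Prop :=
  exists a : nat -> nat -> nat -> R, \forall q \near p,
    summable [set: nat * nat * nat]
      (fun m => (power_term a (q - p) m.1.1 m.1.2 m.2)%:E) /\
    (fun n : nat => \sum_(i < n) \sum_(j < n) \sum_(k < n)
       power_term a (q - p) i j k) @ \oo --> f q.

Definition analytic_atc (R : realType) (f : R * R * R -> R[i])
    (p : R * R * R) : Prop :=
  analytic_at (fun q => complex.Re (f q)) p /\ analytic_at (fun q => complex.Im (f q)) p.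

(* R[i]^o is R[i] with the topology of its norm. *)
Definition extends_continuously (R : realType) (f : R * R * R -> R[i])
    (p : R * R * R) : Prop :=
  exists l : R[i]^o, (f q : R[i]^o) @[q --> p^'] --> l.

(* f(x, y) = O(r^(-2)) as r = |x + iy| -> oo. *)
Definition quadratic_decay (R : realType) (f : R -> R -> R[i]) : Prop :=
  exists M : R, \forall r \near +oo, forall x y : R,
    Num.sqrt (x ^+ 2 + y ^+ 2) = r -> `|f x y| <= (M / r ^+ 2)%:C.

Section Solution.
Variables (R : realType) (C : R).
Implicit Type p : R * R * R.

Definition zc p : R[i] := p.1.1 +i* p.1.2.

Definition gamma p : R[i] := 'i * (p.1.1 ^+ 2 - p.1.2 ^+ 2)%:C.

Definition delta p : R[i] :=
  let: (x, y, t) := p in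
  (- y * (y ^+ 2 / 3 - x ^+ 2 - 1))%:C
  - 'i * (x * (1 + y ^+ 2 - x ^+ 2 / 3) - (C - t))%:C.

Definition denom p : R[i] := `|gamma p| ^+ 2 + `|delta p| ^+ 2.

(* Division is total, with w / 0 = 0, so Ut and Vt take a junk value where
   denom vanishes. *)
Definition Ut p : R[i] :=
  let z := zc p in let g := gamma p in let d := delta p in
  - 'i * ((`|z| ^+ 2 * g^* + g + d * z - d^* * z^*) / denom p).

Definition Vt p : R[i] :=
  let z := zc p in let g := gamma p in let d := delta p in
  let w := z * (g^* - g) - d * z ^+ 2 - d^* in
  w ^+ 2 / denom p ^+ 2
  + 2 * Ut p / (1 + `|z| ^+ 2)
  + 2 * ('i * z^* * w / (denom p * (1 + `|z| ^+ 2))).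

Definition sing : R * R * R := (0, 0, C).

End Solution.

(* Main.v *)
(* Put Q = |gamma|^2 + |delta|^2, which vanishes only at (0, 0, C).  Then U is a
   real quotient n / Q of polynomials, V = d_z^2 (log Q) and
   U^2 = d_z d_zbar (log Q).  After multiplication by Q^3 both equations of the
   system become polynomial identities in z, zbar and C - t.  Analyticity off the
   singular point is that of a rational function, P / (1 - u) = sum_n P u^n with
   u vanishing at the base point.  Since U^2 is a quarter of the Laplacian of
   log Q, its integral over a large square is a quarter of the flux of
   grad (log Q) through the boundary, and log Q ~ 6 log r at infinity gives 3 pi;
   at t = C the singular point, where log Q ~ 2 log r, takes away pi. *)

Require Import Defs.
From HB Require Import structures.
From mathcomp Require Import all_boot all_order all_algebra.
From mathcomp Require Import complex.
From mathcomp Require Import all_classical all_reals all_analysis measurable_realfun.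
From mathcomp Require Import zify ring lra.
From mathcomp Require finmap.

Set Implicit Arguments.
Unset Strict Implicit.
Unset Printing Implicit Defensive.

Import Order.TTheory GRing.Theory Num.Theory.
Import numFieldNormedType.Exports.
Local Open Scope classical_set_scope.
Local Open Scope ring_scope.
Local Open Scope complex_scope.

(** * Rational functions on space-time *)

(** U is real, so the zbar half of the evolution equation is the conjugate of the z half. Its
    right-hand side is therefore X(z, zbar) + X(zbar, z) over Q^3, and z and zbar can be treated as
    independent variables. The integral is taken over squares because on a rectangle Fubini and the
    one-variable fundamental theorem already give the divergence theorem. On a side at distance N
    the normal derivative of k log r is k N / (N^2 + y^2), with an arctangent as primitive. The
    gradient of log Q differs from that of 6 log r by O(N^-2), and a side has length 2 N, so the
    error vanishes in the limit. At t = C no rectangle may contain the singular point, so a strip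
    |x| < d is left out. The comparison with 2 log r on the sides x = d and x = - d has an error of
    order d over a length 2 N; the choice d = N^-2 makes it vanish too. For analyticity each P u^n
    is kept as a finite list of monomials, and convergence is controlled by summing absolute values
    monomial by monomial. *)

Section Ratfun.
Variable R : realType.
Implicit Types (f g : R * R * R -> R) (A : set (R * R * R)) (v p : R * R * R).

(** A predicate on functions, so that continuity, derivatives, re-expansion at a point and
    measurability of slices all follow by induction on the expression. *)
Inductive polyfun : (R * R * R -> R) -> Prop :=
| polyfun_cst c : polyfun (cst c)
| polyfun_x : polyfun (fun p => p.1.1)
| polyfun_y : polyfun (fun p => p.1.2)
| polyfun_t : polyfun (fun p => p.2)
| polyfunD f g : polyfun f -> polyfun g -> polyfun (fun p => f p + g p)
| polyfunM f g : polyfun f -> polyfun g -> polyfun (fun p => f p * g p).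

Lemma polyfunN f : polyfun f -> polyfun (fun p => - f p).
Proof.
move=> pf; have := polyfunM (polyfun_cst (-1)) pf.
by congr polyfun; apply/funext => p /=; rewrite mulN1r.
Qed.

Lemma polyfunB f g : polyfun f -> polyfun g -> polyfun (fun p => f p - g p).
Proof. by move=> pf pg; apply: polyfunD => //; exact: polyfunN. Qed.

Lemma polyfunX f n : polyfun f -> polyfun (fun p => f p ^+ n).
Proof.
move=> pf; elim: n => [|n IH].
  by have := polyfun_cst 1; congr polyfun; apply/funext => p /=; rewrite expr0.
by have := polyfunM pf IH; congr polyfun; apply/funext => p /=; rewrite exprS.
Qed.

Lemma continuous_polyfun f : polyfun f -> continuous f.
Proof.
elim=> {f} [c||||f g _ cf _ cg|f g _ cf _ cg] p.
- exact: cst_continuous.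
- by apply: (@continuous_comp _ _ _ fst fst); exact: cvg_fst.
- by apply: (@continuous_comp _ _ _ fst snd); [exact: cvg_fst|exact: cvg_snd].
- exact: cvg_snd.
- by apply: continuousD; [exact: cf|exact: cg].
- by apply: continuousM; [exact: cf|exact: cg].
Qed.

Lemma is_derive_lin (l : {linear (R * R * R)%type -> R}) p v :
  continuous l -> is_derive p v l (l v).
Proof.
move=> cl; have d : differentiable l p by exact: linear_differentiable.
split; first exact/diff_derivable.
by rewrite deriveE// diff_lin.
Qed.

Lemma is_derive_x p v : is_derive p v (fun q => q.1.1) v.1.1.
Proof. exact: (@is_derive_lin (fst \o fst) p v (continuous_polyfun (polyfun_x))). Qed.

Lemma is_derive_y p v : is_derive p v (fun q => q.1.2) v.1.2.
Proof. exact: (@is_derive_lin (snd \o fst) p v (continuous_polyfun (polyfun_y))). Qed.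

Lemma is_derive_t p v : is_derive p v (fun q => q.2) v.2.
Proof. exact: (@is_derive_lin snd p v (continuous_polyfun (polyfun_t))). Qed.

Lemma polyfun_derive f v : polyfun f ->
  exists2 f', polyfun f' & forall p, is_derive p v f (f' p).
Proof.
elim=> {f} [c||||f g _ [f' pf' df] _ [g' pg' dg]|f g pf [f' pf' df] pg [g' pg' dg]].
- by exists (cst 0) => [|p]; [exact: polyfun_cst|exact: is_derive_cst].
- by exists (cst v.1.1) => [|p]; [exact: polyfun_cst|exact: is_derive_x].
- by exists (cst v.1.2) => [|p]; [exact: polyfun_cst|exact: is_derive_y].
- by exists (cst v.2) => [|p]; [exact: polyfun_cst|exact: is_derive_t].
- exists (fun p => f' p + g' p) => [|p]; first exact: polyfunD.
  exact: is_deriveD.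
- exists (fun p => f p * g' p + g p * f' p) => [|p].
    by apply: polyfunD; exact: polyfunM.
  exact: is_deriveM.
Qed.

(** The values of [f] off [A] are left free: total division gives values at zeros of [Q], and on an
    open [A] continuity and derivatives depend only on the values in [A]. *)
Definition ratfun A f := exists P Q, [/\ polyfun P, polyfun Q &
  forall p, A p -> Q p != 0 /\ f p = P p / Q p].

Lemma polyfun_ratfun A f : polyfun f -> ratfun A f.
Proof.
move=> pf; exists f, (cst 1); split => //; first exact: polyfun_cst.
by move=> p _; rewrite divr1 oner_neq0.
Qed.

Lemma ratfunD A f g : ratfun A f -> ratfun A g -> ratfun A (fun p => f p + g p).
Proof.
move=> [P [Q [pP pQ fE]]] [P' [Q' [pP' pQ' gE]]].
exists (fun p => P p * Q' p + P' p * Q p), (fun p => Q p * Q' p); split.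
- by apply: polyfunD; exact: polyfunM.
- exact: polyfunM.
- move=> p Ap; have [Q0 ->] := fE p Ap; have [Q0' ->] := gE p Ap.
  by rewrite mulf_neq0// addf_div.
Qed.

Lemma ratfunM A f g : ratfun A f -> ratfun A g -> ratfun A (fun p => f p * g p).
Proof.
move=> [P [Q [pP pQ fE]]] [P' [Q' [pP' pQ' gE]]].
exists (fun p => P p * P' p), (fun p => Q p * Q' p); split; try exact: polyfunM.
move=> p Ap; have [Q0 ->] := fE p Ap; have [Q0' ->] := gE p Ap.
by rewrite mulf_neq0// mulf_div.
Qed.

Lemma ratfunV A f : ratfun A f -> (forall p, A p -> f p != 0) ->
  ratfun A (fun p => (f p)^-1).
Proof.
move=> [P [Q [pP pQ fE]]] f0; exists Q, P; split => // p Ap.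
have [Q0 fp] := fE p Ap; move: (f0 p Ap); rewrite fp mulf_eq0 invr_eq0 negb_or.
by move=> /andP[-> _]; rewrite invf_div.
Qed.

Lemma eq_ratfun A f g : (forall p, A p -> f p = g p) -> ratfun A f -> ratfun A g.
Proof.
move=> fg [P [Q [pP pQ fE]]]; exists P, Q; split => // p Ap.
by rewrite -fg//; exact: fE.
Qed.

Lemma ratfunN A f : ratfun A f -> ratfun A (fun p => - f p).
Proof.
move=> rf; apply: eq_ratfun (ratfunM (polyfun_ratfun A (polyfun_cst (-1))) rf) => p _ /=.
by rewrite mulN1r.
Qed.

Lemma ratfun_continuous A f : open A -> ratfun A f ->
  forall p, A p -> {for p, continuous f}.
Proof.
move=> oA [P [Q [pP pQ fE]]] p Ap.
have : {for p, continuous (fun q => P q * (Q q)^-1)}.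
  apply: continuousM; first exact: continuous_polyfun.
  by apply: continuousV; [case: (fE p Ap)|exact: continuous_polyfun].
rewrite /prop_for /continuous_at => c; rewrite (fE p Ap).2.
apply: cvg_trans c; apply: near_eq_cvg.
by apply: filterS (open_nbhs_nbhs (conj oA Ap)) => q Aq; rewrite (fE q Aq).2.
Qed.

Lemma ratfun_derive A f v : open A -> ratfun A f ->
  exists2 f', ratfun A f' & forall p, A p -> is_derive p v f (f' p).
Proof.
move=> oA [P [Q [pP pQ fE]]].
have [P' pP' dP] := polyfun_derive v pP.
have [Q' pQ' dQ] := polyfun_derive v pQ.
exists (fun p => P p * (- (Q p) ^- 2 * Q' p) + (Q p)^-1 * P' p).
  apply: ratfunD; apply: ratfunM; try exact: polyfun_ratfun.
    apply: ratfunM; last exact: polyfun_ratfun.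
    exists (cst (-1)), (fun p => Q p ^+ 2); split.
    - exact: polyfun_cst.
    - exact: polyfunX.
    - by move=> p Ap; rewrite expf_neq0 ?(fE p Ap).1// mulN1r.
  by apply: ratfunV; [exact: polyfun_ratfun|move=> p /fE[]].
move=> p Ap; have [Q0 _] := fE p Ap.
apply: (@near_eq_is_derive _ _ _ (fun q => P q * (Q q)^-1)).
  by apply: filterS (open_nbhs_nbhs (conj oA Ap)) => q Aq; rewrite (fE q Aq).2.
apply: is_deriveM.
split; first exact: derivableV.
by rewrite deriveV// derive_val.
Qed.

(** Every directional derivative is again rational on [A], so the induction on [k] runs over all [f]
    at once. *)
Lemma ratfun_class_C A k f : open A -> ratfun A f -> class_C k A f.
Proof.
move=> oA; elim: k f => [|k IH] f rf /=; (split; first exact: ratfun_continuous) => //.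
move=> v; have [f' rf' df] := ratfun_derive v oA rf.
split; first by move=> p /df[].
apply: IH; apply: eq_ratfun rf' => p Ap.
by apply/esym; apply: derive_val; exact: df.
Qed.

End Ratfun.

(** * Wirtinger derivatives *)

Section Wirtinger.
Variable R : realType.
Implicit Types (F G d : R * R * R -> R[i]) (v p : R * R * R).

Lemma imaginaryE : 'i%R = 0 +i* 1 :> R[i].
Proof. by []. Qed.

Lemma conjE (x : R[i]) : (x^*)%R = x^*.
Proof. by []. Qed.

Lemma sqr_norm_complexE (a b : R) : `|a +i* b| ^+ 2 = (a ^+ 2 + b ^+ 2)%:C.
Proof. by rewrite normCK conjE/=; simpc; congr (_ +i* _); ring. Qed.

Definition cderiv F p v (d : R[i]) :=
  is_derive p v (fun q => complex.Re (F q)) (complex.Re d) /\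
  is_derive p v (fun q => complex.Im (F q)) (complex.Im d).

Definition cderivable F p := forall v,
  derivable (fun q => complex.Re (F q)) p v /\ derivable (fun q => complex.Im (F q)) p v.

Lemma cderivableP F p : cderivable F p -> forall v, cderiv F p v (partial v F p).
Proof. by move=> dF v; have [d1 d2] := dF v; split; exact: derivableP. Qed.

Lemma cderiv_partial F p v (d : R[i]) : cderiv F p v d -> partial v F p = d.
Proof. by case: d => a b [[_ d1] [_ d2]]; rewrite /partial d1 d2. Qed.

Lemma cderivM F G p v (d e : R[i]) : cderiv F p v d -> cderiv G p v e ->
  cderiv (fun q => F q * G q) p v (F p * e + G p * d).
Proof.
move=> [F1 F2] [G1 G2].
have dRe := is_deriveB (is_deriveM F1 G1) (is_deriveM F2 G2).
have dIm := is_deriveD (is_deriveM F1 G2) (is_deriveM F2 G1).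
split; [move: dRe {dIm F1 F2 G1 G2}|move: dIm {dRe F1 F2 G1 G2}]; congr (is_derive p v _ _).
- by apply/funext => q; rewrite !fctE; case: (F q) => ? ?; case: (G q).
- rewrite /GRing.scale/=; case: (F p) => ? ?; case: (G p) => ? ?.
  by case: d => ? ?; case: e => ? ? /=; ring.
- by apply/funext => q; rewrite !fctE; case: (F q) => ? ?; case: (G q).
- rewrite /GRing.scale/=; case: (F p) => ? ?; case: (G p) => ? ?.
  by case: d => ? ?; case: e => ? ? /=; ring.
Qed.

Lemma cderivD F G p v (d e : R[i]) : cderiv F p v d -> cderiv G p v e ->
  cderiv (fun q => F q + G q) p v (d + e).
Proof.
move=> [F1 F2] [G1 G2]; have dRe := is_deriveD F1 G1; have dIm := is_deriveD F2 G2.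
split; [move: dRe {dIm F1 F2 G1 G2}|move: dIm {dRe F1 F2 G1 G2}]; congr (is_derive p v _ _).
- by apply/funext => q; rewrite !fctE; case: (F q) => ? ?; case: (G q).
- by case: d => ? ?; case: e.
- by apply/funext => q; rewrite !fctE; case: (F q) => ? ?; case: (G q).
- by case: d => ? ?; case: e.
Qed.

Lemma cderivableM F G p : cderivable F p -> cderivable G p ->
  cderivable (fun q => F q * G q) p.
Proof.
move=> /cderivableP dF /cderivableP dG v.
by have [[d1 _] [d2 _]] := cderivM (dF v) (dG v).
Qed.

Lemma partialM v F G p : cderivable F p -> cderivable G p ->
  partial v (fun q => F q * G q) p = F p * partial v G p + G p * partial v F p.
Proof.
by move=> /cderivableP dF /cderivableP dG; apply: cderiv_partial; exact: cderivM.
Qed.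

Lemma cderivableD F G p : cderivable F p -> cderivable G p ->
  cderivable (fun q => F q + G q) p.
Proof.
move=> /cderivableP dF /cderivableP dG v.
by have [[d1 _] [d2 _]] := cderivD (dF v) (dG v).
Qed.

Lemma partialD v F G p : cderivable F p -> cderivable G p ->
  partial v (fun q => F q + G q) p = partial v F p + partial v G p.
Proof.
by move=> /cderivableP dF /cderivableP dG; apply: cderiv_partial; exact: cderivD.
Qed.

Lemma cderivable_cst (c : R[i]) p : cderivable (cst c) p.
Proof. by move=> v; split; exact: derivable_cst. Qed.

Lemma partial_cst v (c : R[i]) p : partial v (cst c) p = 0.
Proof. by rewrite /partial !derive_cst. Qed.

Lemma near_eq_partial v F G p : (\near p, F p = G p) ->
  partial v F p = partial v G p.
Proof.
move=> FG; rewrite /partial; congr (_ +i* _); apply: near_eq_derive;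
  by apply: filterS FG => q ->.
Qed.

Lemma near_eq_cderivable F G p : (\near p, F p = G p) ->
  cderivable F p -> cderivable G p.
Proof.
move=> FG dF v; have [d1 d2] := dF v.
by split; [move: d1|move: d2]; apply: near_eq_derivable; apply: filterS FG => q ->.
Qed.

Lemma cderivableV F p : (\near p, F p != 0) -> cderivable F p ->
  cderivable (fun q => (F q)^-1) p.
Proof.
move=> F0 dF v; have [d1 d2] := dF v.
(* The inverse of F is its conjugate over [N], the squared modulus, so both components are real
   quotients. *)
pose N q := complex.Re (F q) ^+ 2 + complex.Im (F q) ^+ 2.
have Np : N p != 0.
  have := nbhs_singleton F0; rewrite /N; case: (F p) => a b /=; apply: contraNneq => /eqP.
  by rewrite paddr_eq0 ?sqr_ge0// !sqrf_eq0 eq_complex.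
have dN : derivable N p v.
  move: (derivableD (derivableM d1 d1) (derivableM d2 d2)).
  by congr (derivable _ p v); apply/funext => q; rewrite !fctE.
have dV : derivable (fun q => (N q)^-1) p v by exact: derivableV.
have NE q : (F q)^-1 = complex.Re (F q) / N q +i* - (complex.Im (F q) / N q).
  by rewrite /N; case: (F q).
split.
- move: (derivableM d1 dV).
  by congr (derivable _ p v); apply/funext => q; rewrite fctE NE.
- move: (derivableN (derivableM d2 dV)).
  by congr (derivable _ p v); apply/funext => q; rewrite !fctE NE.
Qed.

(** Differentiating [F q * (F q)^-1 = 1], valid near [p], yields the value without a computation in
    components. *)
Lemma partialV v F p : (\near p, F p != 0) -> cderivable F p ->
  partial v (fun q => (F q)^-1) p = - (F p)^-1 ^+ 2 * partial v F p.
Proof.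
move=> F0 dF; have dV := cderivableV F0 dF.
have Fp : F p != 0 := nbhs_singleton F0.
have : partial v (fun q => F q * (F q)^-1) p = 0.
  rewrite -(partial_cst v 1 p); apply: near_eq_partial.
  by apply: filterS F0 => q q0; rewrite divff.
rewrite partialM// => /eqP; rewrite addr_eq0 => /eqP H.
by apply: (mulfI Fp); rewrite H; field.
Qed.

Variables (al be ga : R[i]) (A : set (R * R * R)).
Hypothesis oA : open A.

(* dz, dzbar and dt are the three instances of interest. *)
Definition wirt F p := al * partial ex F p + be * partial ey F p + ga * partial et F p.

(** Derivability travels with the value because the product and inverse rules require it. Only
    values on [A] count, so a formula valid on the open [A] can be differentiated again. *)
Definition is_wirt F d := forall p, A p -> cderivable F p /\ wirt F p = d p.

Lemma nbhs_on p : A p -> \near p, A p.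
Proof. by move=> Ap; exact: open_nbhs_nbhs. Qed.

Lemma is_wirt_eq F d d' : is_wirt F d -> (forall p, A p -> d p = d' p) -> is_wirt F d'.
Proof. by move=> h e p Ap; rewrite -e//; exact: h. Qed.

Lemma eq_is_wirt F G d : is_wirt F d -> (forall p, A p -> F p = G p) -> is_wirt G d.
Proof.
move=> h e p Ap; have [h1 h2] := h p Ap.
have FG : \near p, F p = G p by apply: filterS (nbhs_on Ap).
by split; [exact: near_eq_cderivable h1|rewrite /wirt -!(near_eq_partial _ FG)].
Qed.

Lemma is_wirt_cst c : is_wirt (cst c) (cst 0).
Proof.
by move=> p _; split; [exact: cderivable_cst|rewrite /wirt !partial_cst !mulr0 !addr0].
Qed.

Lemma is_wirtD F G d e : is_wirt F d -> is_wirt G e ->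
  is_wirt (fun p => F p + G p) (fun p => d p + e p).
Proof.
move=> hF hG p Ap; have [dF <-] := hF p Ap; have [dG <-] := hG p Ap.
split; [exact: cderivableD|rewrite /wirt !partialD//].
move: (partial ex F p) (partial ey F p) (partial et F p) (partial ex G p)
  (partial ey G p) (partial et G p) => *; ring.
Qed.

Lemma is_wirtM F G d e : is_wirt F d -> is_wirt G e ->
  is_wirt (fun p => F p * G p) (fun p => d p * G p + F p * e p).
Proof.
move=> hF hG p Ap; have [dF <-] := hF p Ap; have [dG <-] := hG p Ap.
split; [exact: cderivableM|rewrite /wirt !partialM//].
move: (partial ex F p) (partial ey F p) (partial et F p) (partial ex G p)
  (partial ey G p) (partial et G p) => *; ring.
Qed.

Lemma is_wirtZ c F d : is_wirt F d -> is_wirt (fun p => c * F p) (fun p => c * d p).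
Proof.
move=> hF; apply: is_wirt_eq (is_wirtM (is_wirt_cst c) hF) _ => p _ /=.
by rewrite mul0r add0r.
Qed.

Lemma is_wirtN F d : is_wirt F d -> is_wirt (fun p => - F p) (fun p => - d p).
Proof.
move=> hF; have h := is_wirtZ (-1) hF.
apply: is_wirt_eq (eq_is_wirt h _) _ => p _ /=; by rewrite mulN1r.
Qed.

Lemma is_wirtX F d n : is_wirt F d ->
  is_wirt (fun p => F p ^+ n) (fun p => n%:R * F p ^+ n.-1 * d p).
Proof.
move=> hF; elim: n => [|n IH].
  apply: is_wirt_eq (eq_is_wirt (is_wirt_cst 1) _) _ => p _ //=.
  by rewrite !mul0r.
apply: is_wirt_eq (eq_is_wirt (is_wirtM hF IH) _) _ => p _ /=; first by rewrite exprS.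
case: n {IH} => [|n] /=; first by rewrite !expr0; ring.
by rewrite exprS -[n.+2]addn1 natrD; ring.
Qed.

Lemma is_wirtV F d : is_wirt F d -> (forall p, A p -> F p != 0) ->
  is_wirt (fun p => (F p)^-1) (fun p => - (F p)^-1 ^+ 2 * d p).
Proof.
move=> hF F0 p Ap; have [dF <-] := hF p Ap.
have F0' : \near p, F p != 0 by apply: filterS (nbhs_on Ap).
split; [exact: cderivableV|rewrite /wirt !partialV//].
move: (partial ex F p) (partial ey F p) (partial et F p) => *; ring.
Qed.

Lemma wirtE F d p : is_wirt F d -> A p -> wirt F p = d p.
Proof. by move=> h Ap; case: (h p Ap). Qed.

Lemma eq_wirt F G p : (forall q, A q -> F q = G q) -> A p -> wirt F p = wirt G p.
Proof.
move=> e Ap; have FG : \near p, F p = G p by apply: filterS (nbhs_on Ap).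
by rewrite /wirt -!(near_eq_partial _ FG).
Qed.

End Wirtinger.

(** * Polynomial forms of the solution *)

Section Forms.
Variable K : numFieldType.
Implicit Types z w s : K.

(* At [w = zbar] and [s = C - t], [pQ = |gamma|^2 + |delta|^2] and [U = pn / pQ];
   [pQi] and [pni] are the i-th z-derivatives of [pQ] and [pn],
   [pV = d_z^2 (log pQ)], and [pX / pQ^3 = U_zzz + 3 U_z V + 3/2 U V_z]. *)
Definition pQ z w s := ((z ^+ 2 + w ^+ 2) / 2) ^+ 2
  + (w - z ^+ 3 / 3 - s) * (z - w ^+ 3 / 3 - s).
Definition pn z w s := s * (z + w) - (z ^+ 2 + w ^+ 2) / 2 * (1 + z * w / 3).
Definition pQ1 z w s := (z ^+ 2 + w ^+ 2) * z - z ^+ 2 * (z - w ^+ 3 / 3 - s)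
  + (w - z ^+ 3 / 3 - s).
Definition pQ2 z w s := z ^+ 2 + w ^+ 2 - 2 * z * (z - w ^+ 3 / 3 - s).
Definition pQ3 z w s := - (2 * (z - w ^+ 3 / 3 - s)).
Definition pn1 z w s := s - z * (1 + z * w / 3) - (z ^+ 2 + w ^+ 2) / 2 * w / 3.
Definition pn2 z w := - (1 + z * w).
Definition pV z w s := pQ2 z w s / pQ z w s - (pQ1 z w s / pQ z w s) ^+ 2.
Definition pX z w s := - w * pQ z w s ^+ 2 - 3 * pn2 z w * pQ1 z w s * pQ z w s
  + 3 * pn1 z w s * pQ1 z w s ^+ 2
  + pn z w s * (pQ3 z w s * pQ z w s / 2 - 3 / 2 * pQ1 z w s * pQ2 z w s).

End Forms.

(** Applied to conjugation, it turns X(z, zbar) into X(zbar, z). *)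
Lemma rmorph_pX (K L : numFieldType) (f : {rmorphism K -> L}) (z w s : K) :
  f (pX z w s) = pX (f z) (f w) (f s).
Proof.
rewrite /pX /pQ /pn /pn1 /pn2 /pQ1 /pQ2 /pQ3.
by rewrite !(rmorphXn, rmorphN, rmorph_nat, fmorphV, rmorph1, rmorphD, rmorphM).
Qed.

(** Applied to the embedding of the reals, it turns V on the real axis at t = C into a real
    expression. *)
Lemma rmorph_pV (K L : numFieldType) (f : {rmorphism K -> L}) (z w s : K) :
  f (pV z w s) = pV (f z) (f w) (f s).
Proof.
rewrite /pV /pQ /pQ1 /pQ2.
by rewrite !(rmorphXn, rmorphN, rmorph_nat, fmorphV, rmorph1, rmorphD, rmorphM).
Qed.

Section RealForms.
Variables (R : realType) (C : R).
Implicit Type p : R * R * R.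

(** Q in real coordinates, with s = C - t. This form serves positivity, decay and the integral; the
    complex form [pQ] serves the differential equations. *)
Definition rden (x y s : R) := (x ^+ 2 - y ^+ 2) ^+ 2
  + (y + x ^+ 2 * y - y ^+ 3 / 3) ^+ 2 + (x * (1 + y ^+ 2 - x ^+ 2 / 3) - s) ^+ 2.
Definition rnum (x y s : R) :=
  2 * s * x - (x ^+ 2 - y ^+ 2) * (1 + (x ^+ 2 + y ^+ 2) / 3).

Lemma real_complex_div (a b : R) : (a / b)%:C = a%:C / b%:C.
Proof. exact: (fmorph_div (real_complex R)). Qed.

Lemma real_complex_inv_nat n : (n%:R)^-1 = (n%:R^-1)%:C :> R[i].
Proof. by rewrite (fmorphV (real_complex R)) (rmorph_nat (real_complex R)). Qed.

Lemma gammaE p : gamma p = 0 +i* (p.1.1 ^+ 2 - p.1.2 ^+ 2).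
Proof. by rewrite /gamma imaginaryE; simpc. Qed.

Lemma deltaE x y t : delta C (x, y, t) = (y + x ^+ 2 * y - y ^+ 3 / 3)
  -i* (x * (1 + y ^+ 2 - x ^+ 2 / 3) - (C - t)).
Proof. by rewrite /delta imaginaryE; simpc; congr (_ +i* _); ring. Qed.

Lemma denomE p : denom C p = (rden p.1.1 p.1.2 (C - p.2))%:C.
Proof.
case: p => [[x y] t]; rewrite /denom gammaE deltaE !sqr_norm_complexE -rmorphD.
by congr (_%:C); rewrite /rden /=; ring.
Qed.

(** The three squares vanish separately. With x^2 = y^2 the base of the second becomes y (1 + 2/3
    y^2), which forces y = 0, hence x = 0, and then the third gives s = 0. *)
Lemma rden_eq0 (x y s : R) : (rden x y s == 0) = [&& x == 0, y == 0 & s == 0].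
Proof.
apply/idP/idP => [|/and3P[/eqP-> /eqP-> /eqP->]]; last first.
  by rewrite /rden; apply/eqP; ring.
rewrite /rden !paddr_eq0 ?addr_ge0 ?sqr_ge0// !sqrf_eq0 => /andP[/andP[]].
rewrite subr_eq0 => /eqP xy.
have -> : y + x ^+ 2 * y - y ^+ 3 / 3 = y * (1 + 2 / 3 * y ^+ 2) by rewrite xy; field.
rewrite mulf_eq0 => /orP[/eqP y0|]; last first.
  by rewrite gt_eqF// ltr_pwDl// mulr_ge0 ?sqr_ge0// divr_ge0.
have /eqP x0 : x == 0 by move/eqP: xy; rewrite y0 expr0n sqrf_eq0.
by rewrite x0 y0 eqxx mul0r sub0r oppr_eq0.
Qed.

Lemma rden_ge0 (x y s : R) : 0 <= rden x y s.
Proof. by rewrite /rden !addr_ge0 ?sqr_ge0. Qed.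

Lemma rden_gt0 (x y s : R) : [|| x != 0, y != 0 | s != 0] -> 0 < rden x y s.
Proof. by move=> h; rewrite lt_neqAle rden_ge0 andbT eq_sym rden_eq0 !negb_and. Qed.

Lemma denom_eq0 p : denom C p = 0 <-> p = sing C.
Proof.
rewrite denomE; case: p => [[x y] t] /=; split => [|[-> -> ->]]; last first.
  by congr (_%:C); apply/eqP; rewrite rden_eq0 subrr !eqxx.
move=> [/eqP]; rewrite rden_eq0 => /and3P[/eqP-> /eqP->].
by rewrite subr_eq0 => /eqP<-.
Qed.

Lemma UtE p : Ut C p = (rnum p.1.1 p.1.2 (C - p.2) / rden p.1.1 p.1.2 (C - p.2))%:C.
Proof.
rewrite /Ut denomE real_complex_div mulrA; congr (_ / _).
case: p => [[x y] t]; rewrite /zc gammaE deltaE !imaginaryE !conjE sqr_norm_complexE; simpc => /=.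
by rewrite /rnum; congr (_ +i* _); field.
Qed.

Lemma rden_pQ (x y s : R) : (rden x y s)%:C = pQ (x +i* y) (x -i* y) s%:C.
Proof.
rewrite /pQ (real_complex_inv_nat 2).
rewrite (real_complex_inv_nat 3) !exprS !expr0 !mulr1.
by simpc; rewrite /rden; congr (_ +i* _); field.
Qed.

Lemma rnum_pn (x y s : R) : (rnum x y s)%:C = pn (x +i* y) (x -i* y) s%:C.
Proof.
rewrite /pn (real_complex_inv_nat 2).
rewrite (real_complex_inv_nat 3) !exprS !expr0 !mulr1.
by simpc; rewrite /rnum; congr (_ +i* _); field.
Qed.

(** The bracket squared in V is - i Q_z, so the first term is - (Q_z / Q)^2. The other two combine
    to 2 (n + zbar Q_z) / (Q (1 + |z|^2)), which is Q_zz / Q because 2 (n + zbar Q_z) = Q_zz (1 +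
    |z|^2). *)
Lemma VtE p : Vt C p = pV (zc p) (zc p)^* (C - p.2)%:C.
Proof.
rewrite /Vt /pV !conjE.
set z := zc p; set w := z^*; set s := (C - p.2)%:C; set q := denom C p.
have qE : q = pQ z w s by rewrite /q denomE rden_pQ; case: p @z @w @s {q} => [[]].
have gE : gamma p = 'i * ((z ^+ 2 + w ^+ 2) / 2).
  rewrite /gamma /w /z; case: p {z w s q qE} => [[x y] t]; rewrite /zc /=; congr (_ * _).
  rewrite (real_complex_inv_nat 2) !exprS !expr0 !mulr1.
  by simpc; congr (_ +i* _); field.
have dE : delta C p = - 'i * (z - w ^+ 3 / 3 - s).
  rewrite /s /w /z; case: p {z w s q qE gE} => [[x y] t]; rewrite deltaE /zc/=.
  rewrite (real_complex_inv_nat 3) !exprS !expr0 !mulr1 imaginaryE.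
  by simpc; congr (_ +i* _); field.
have gE' : (gamma p)^* = - gamma p.
  by rewrite /gamma imaginaryE; simpc => /=; congr (_ +i* _); ring.
have dE' : (delta C p)^* = 'i * (w - z ^+ 3 / 3 - s).
  rewrite /s /w /z; case: p {z w s q qE gE gE' dE} => [[x y] t]; rewrite deltaE /zc/=.
  rewrite (real_complex_inv_nat 3) !exprS !expr0 !mulr1 imaginaryE.
  by simpc; congr (_ +i* _); field.
have nE : Ut C p = pn z w s / q.
  rewrite UtE qE real_complex_div rden_pQ rnum_pn.
  by case: p @z @w @s {q qE gE dE gE' dE'} => [[]].
have zzE : `|z| ^+ 2 = z * w by rewrite normCK.
rewrite gE' dE' dE gE nE zzE -qE.
have r0 : 1 + z * w != 0.
  by rewrite -zzE gt_eqF// ltr_pwDl// exprn_ge0.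
rewrite [X in X ^+ 2 / _](_ : _ = - 'i * pQ1 z w s); last by rewrite /pQ1; field.
rewrite [X in 'i * w * X](_ : _ = - 'i * pQ1 z w s); last by rewrite /pQ1; field.
rewrite !exprMn sqrrN sqrCi mulN1r mulNr.
rewrite (_ : 'i * w * (- 'i * pQ1 z w s) = - 'i ^+ 2 * (w * pQ1 z w s)); last by ring.
rewrite sqrCi opprK mul1r.
have key : 2 * (pn z w s + w * pQ1 z w s) = pQ2 z w s * (1 + z * w).
  by rewrite /pn /pQ1 /pQ2; field.
transitivity (- (pQ1 z w s / q) ^+ 2
  + 2 * (pn z w s + w * pQ1 z w s) / (1 + z * w) / q).
  rewrite -exprVn invfM; move: (q^-1) ((1 + z * w)^-1) => qi ri; ring.
by rewrite key mulfK// addrC exprMn.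
Qed.
End RealForms.

(** * Regularity of U and V away from the singular point *)

Section ComplexRatfun.
Variables (R : realType) (A : set (R * R * R)).
Implicit Types F G : R * R * R -> R[i].

Definition cratfun F :=
  ratfun A (fun q => complex.Re (F q)) /\ ratfun A (fun q => complex.Im (F q)).

Lemma cratfun_cst c : cratfun (cst c).
Proof. by split; apply: polyfun_ratfun; exact: polyfun_cst. Qed.

Lemma cratfunD F G : cratfun F -> cratfun G -> cratfun (fun p => F p + G p).
Proof.
move=> [F1 F2] [G1 G2]; split.
- apply: eq_ratfun (ratfunD F1 G1) => p _; by case: (F p) => ? ?; case: (G p).
- apply: eq_ratfun (ratfunD F2 G2) => p _; by case: (F p) => ? ?; case: (G p).
Qed.

Lemma cratfunM F G : cratfun F -> cratfun G -> cratfun (fun p => F p * G p).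
Proof.
move=> [F1 F2] [G1 G2]; split.
- apply: eq_ratfun (ratfunD (ratfunM F1 G1) (ratfunN (ratfunM F2 G2))) => p _.
  by case: (F p) => ? ?; case: (G p).
- apply: eq_ratfun (ratfunD (ratfunM F1 G2) (ratfunM F2 G1)) => p _.
  by case: (F p) => ? ?; case: (G p).
Qed.

Lemma cratfunN F : cratfun F -> cratfun (fun p => - F p).
Proof.
move=> rF; have : (fun p => cst (-1) p * F p) = (fun p => - F p).
  by apply/funext => p; rewrite mulN1r.
by move=> <-; apply: cratfunM => //; exact: cratfun_cst.
Qed.

Lemma cratfunX F n : cratfun F -> cratfun (fun p => F p ^+ n).
Proof.
move=> rF; elim: n => [|n IH]; first exact: (cratfun_cst 1).
by under eq_fun do rewrite exprS; exact: cratfunM.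
Qed.

Lemma cratfun_real f : ratfun A f -> cratfun (fun p => (f p)%:C).
Proof. by move=> rf; split => //=; apply: polyfun_ratfun; exact: polyfun_cst. Qed.

End ComplexRatfun.

Lemma polyfun_s (R : realType) (C : R) : polyfun (fun p : R * R * R => C - p.2).
Proof. by apply: polyfunB; [exact: polyfun_cst|exact: polyfun_t]. Qed.

Ltac polyfun_auto := repeat first
  [exact: polyfun_x | exact: polyfun_y | exact: polyfun_s | exact: polyfun_cst
  | apply: polyfunB | apply: polyfunD | apply: polyfunX | apply: polyfunN | apply: polyfunM].

Section Regularity.
Variables (R : realType) (C : R).
Let A : set (R * R * R) := [set p | p != sing C].

Lemma open_neq_sing : open A.
Proof.
have -> : A = ~` [set sing C].
  by apply/seteqP; split => p /= /eqP.
rewrite openC; apply: accessible_closed_set1; apply: hausdorff_accessible.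
exact: norm_hausdorff.
Qed.

Lemma polyfun_rden : polyfun (fun p : R * R * R => rden p.1.1 p.1.2 (C - p.2)).
Proof. by rewrite /rden; polyfun_auto. Qed.

Lemma polyfun_rnum : polyfun (fun p : R * R * R => rnum p.1.1 p.1.2 (C - p.2)).
Proof. by rewrite /rnum; polyfun_auto. Qed.

Lemma rden_neq0 p : A p -> rden p.1.1 p.1.2 (C - p.2) != 0.
Proof.
move=> /eqP h; apply/eqP => h0; apply: h.
by apply/denom_eq0; rewrite denomE h0.
Qed.

Lemma ratfun_rdenV : ratfun A (fun p : R * R * R => (rden p.1.1 p.1.2 (C - p.2))^-1).
Proof.
by apply: ratfunV; [exact: polyfun_ratfun polyfun_rden|exact: rden_neq0].
Qed.

Lemma cratfun_Ut : cratfun A (Ut C).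
Proof.
rewrite (_ : Ut C = fun p => (rnum p.1.1 p.1.2 (C - p.2) / rden p.1.1 p.1.2 (C - p.2))%:C).
  by apply: cratfun_real; apply: ratfunM ratfun_rdenV; exact: polyfun_ratfun polyfun_rnum.
by apply/funext => p; rewrite UtE.
Qed.

Lemma cratfun_zc : cratfun A (@zc R).
Proof.
by split; apply: polyfun_ratfun; [exact: polyfun_x|exact: polyfun_y].
Qed.

Lemma cratfun_zbar : cratfun A (fun p => (zc p)^*).
Proof.
split; apply: polyfun_ratfun; first exact: polyfun_x.
by apply: polyfunN; exact: polyfun_y.
Qed.

Lemma pQ_zc p : pQ (zc p) (zc p)^* (C - p.2)%:C = (rden p.1.1 p.1.2 (C - p.2))%:C.
Proof. by rewrite rden_pQ. Qed.

Lemma pn_zc p : pn (zc p) (zc p)^* (C - p.2)%:C = (rnum p.1.1 p.1.2 (C - p.2))%:C.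
Proof. by rewrite rnum_pn. Qed.

Lemma cratfun_pQV : cratfun A (fun p => (pQ (zc p) (zc p)^* (C - p.2)%:C)^-1).
Proof.
rewrite (_ : (fun _ => _) = fun p => ((rden p.1.1 p.1.2 (C - p.2))^-1)%:C).
  by apply: cratfun_real; exact: ratfun_rdenV.
by apply/funext => p; rewrite pQ_zc (fmorphV (real_complex R)).
Qed.

Lemma cratfun_Vt : cratfun A (Vt C).
Proof.
rewrite (_ : Vt C = fun p => pV (zc p) (zc p)^* (C - p.2)%:C); last first.
  by apply/funext => p; rewrite VtE.
rewrite /pV /pQ1 /pQ2; repeat first
  [exact: cratfun_pQV | exact: cratfun_zc | exact: cratfun_zbar
  | exact: cratfun_real (polyfun_ratfun A (polyfun_s C)) | exact: cratfun_cst
  | apply: cratfunN | apply: cratfunD | apply: cratfunX | apply: cratfunM].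
Qed.

Lemma class_Cc_Ut : class_Cc 3 A (Ut C).
Proof. by have [? ?] := cratfun_Ut; split; apply: ratfun_class_C => //; exact: open_neq_sing. Qed.

Lemma class_Cc_Vt : class_Cc 1 A (Vt C).
Proof. by have [? ?] := cratfun_Vt; split; apply: ratfun_class_C => //; exact: open_neq_sing. Qed.

End Regularity.

(** * The modified Novikov-Veselov equation *)

Section Quotient.
Variables (R : realType) (al be ga : R[i]) (A : set (R * R * R)).
Hypothesis oA : open A.
Local Notation is_der := (is_wirt al be ga A).
Variables n n1 n2 n3 q q1 q2 q3 : R * R * R -> R[i].
Hypothesis q0 : forall p, A p -> q p != 0.
Hypotheses (hn : is_der n n1) (hn1 : is_der n1 n2) (hn2 : is_der n2 n3).
Hypotheses (hq : is_der q q1) (hq1 : is_der q1 q2) (hq2 : is_der q2 q3).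

Let hqV : is_der (fun p => (q p)^-1) (fun p => - (q p)^-1 ^+ 2 * q1 p).
Proof. exact: (is_wirtV oA hq q0). Qed.

(** The derivative is an existential variable, filled in by descending through the syntax of the
    function; [ring] then compares it with the stated form. *)
Ltac is_der_auto := lazymatch goal with
  | |- is_wirt _ _ _ _ (fun p => (q p)^-1) _ => exact hqV
  | |- is_wirt _ _ _ _ (fun p => n p) _ => exact hn
  | |- is_wirt _ _ _ _ (fun p => n1 p) _ => exact hn1
  | |- is_wirt _ _ _ _ (fun p => n2 p) _ => exact hn2
  | |- is_wirt _ _ _ _ (fun p => q1 p) _ => exact hq1
  | |- is_wirt _ _ _ _ (fun p => q2 p) _ => exact hq2
  | |- is_wirt _ _ _ _ (fun p => @?F p + @?G p) _ =>
    refine (@is_wirtD R al be ga A F G _ _ _ _); is_der_auto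
  | |- is_wirt _ _ _ _ (fun p => - @?F p) _ =>
    refine (@is_wirtN R al be ga A oA F _ _); is_der_auto
  | |- is_wirt _ _ _ _ (fun p => @?F p ^+ ?n) _ =>
    refine (@is_wirtX R al be ga A oA F _ n _); is_der_auto
  | |- is_wirt _ _ _ _ (fun p => @?F p * @?G p) _ =>
    refine (@is_wirtM R al be ga A F G _ _ _ _); is_der_auto
  | |- is_wirt _ _ _ _ (fun p => ?c) _ => exact (@is_wirt_cst R al be ga A c)
  end.

Lemma is_der_quot1 : is_der (fun p => n p / q p)
  (fun p => n1 p / q p - n p * q1 p * (q p)^-1 ^+ 2).
Proof.
eapply is_wirt_eq; first is_der_auto.
by move=> p _ /=; move: (n p) (n1 p) (q1 p) (q p)^-1 => *; ring.
Qed.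

Lemma is_der_quot2 : is_der (fun p => n1 p / q p - n p * q1 p * (q p)^-1 ^+ 2)
  (fun p => n2 p / q p - (2 * n1 p * q1 p + n p * q2 p) * (q p)^-1 ^+ 2
     + 2 * n p * q1 p ^+ 2 * (q p)^-1 ^+ 3).
Proof.
eapply is_wirt_eq; first is_der_auto.
by move=> p _ /=; move: (n p) (n1 p) (n2 p) (q1 p) (q2 p) (q p)^-1 => *; ring.
Qed.

Lemma is_der_quot3 : is_der
  (fun p => n2 p / q p - (2 * n1 p * q1 p + n p * q2 p) * (q p)^-1 ^+ 2
     + 2 * n p * q1 p ^+ 2 * (q p)^-1 ^+ 3)
  (fun p => n3 p / q p
     - (3 * n2 p * q1 p + 3 * n1 p * q2 p + n p * q3 p) * (q p)^-1 ^+ 2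
     + (6 * n1 p * q1 p ^+ 2 + 6 * n p * q1 p * q2 p) * (q p)^-1 ^+ 3
     - 6 * n p * q1 p ^+ 3 * (q p)^-1 ^+ 4).
Proof.
eapply is_wirt_eq; first is_der_auto.
move=> p _ /=; move: (n p) (n1 p) (n2 p) (n3 p) (q1 p) (q2 p) (q3 p) (q p)^-1 => *.
ring.
Qed.

Lemma is_der_log2 : is_der (fun p => q2 p / q p - (q1 p / q p) ^+ 2)
  (fun p => q3 p / q p - 3 * q1 p * q2 p * (q p)^-1 ^+ 2
     + 2 * q1 p ^+ 3 * (q p)^-1 ^+ 3).
Proof.
eapply is_wirt_eq; first is_der_auto.
by move=> p _ /=; move: (q1 p) (q2 p) (q3 p) (q p)^-1 => *; ring.
Qed.

End Quotient.

(** * Derivatives of Q and n *)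

Section PDE.
Variables (R : realType) (C : R).
Let A : set (R * R * R) := [set p | p != sing C].
Let oA : open A := @open_neq_sing R C.
Local Notation Z p := (zc p).
Local Notation W p := ((zc p)^*).
Local Notation S p := ((C - p.2)%:C).

Lemma partial_zc v p : cderiv (@zc R) p v (v.1.1 +i* v.1.2).
Proof. by split; [exact: is_derive_x|exact: is_derive_y]. Qed.

Lemma partial_zbar v p : cderiv (fun q : R * R * R => W q) p v (v.1.1 -i* v.1.2).
Proof. by split; [exact: is_derive_x|exact: (is_deriveN (is_derive_y _ _))]. Qed.

Lemma partial_s v p : cderiv (fun q : R * R * R => S q) p v (- v.2)%:C.
Proof.
split; last exact: is_derive_cst.
by rewrite -[complex.Re _]add0r; apply: is_deriveB; exact: is_derive_t.
Qed.

Section Derivation.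
Variables (al be ga a b c : R[i]).
Hypothesis (az : al + be * 'i = a) (bz : al - be * 'i = b) (cz : - ga = c).
Local Notation is_der := (is_wirt al be ga A).

Lemma cderiv_cderivable F p (d : R * R * R -> R[i]) :
  (forall v, cderiv F p v (d v)) -> cderivable F p.
Proof. by move=> h v; have [[]] := h v; move=> ? _ []. Qed.

Lemma is_der_zc : is_der (@zc R) (cst a).
Proof.
move=> p _; split; first exact: (cderiv_cderivable (partial_zc ^~ p)).
rewrite /wirt !(cderiv_partial (partial_zc _ p)) /= -az.
by rewrite -[1 +i* 0]/(1 : R[i]) -[0 +i* 0]/(0 : R[i]) mulr1 mulr0 addr0.
Qed.

Lemma is_der_zbar : is_der (fun p : R * R * R => W p) (cst b).
Proof.
move=> p _; split; first exact: (cderiv_cderivable (partial_zbar ^~ p)).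
rewrite /wirt !(cderiv_partial (partial_zbar _ p)) /= -bz oppr0.
rewrite -[1 +i* 0]/(1 : R[i]) -[0 +i* 0]/(0 : R[i]) mulr1 mulr0 addr0.
by rewrite -mulrN imaginaryE; simpc.
Qed.

Lemma is_der_s : is_der (fun p : R * R * R => S p) (cst c).
Proof.
move=> p _; split; first exact: (cderiv_cderivable (partial_s ^~ p)).
rewrite /wirt !(cderiv_partial (partial_s _ p)) /= -cz oppr0 !mulr0 !add0r.
by rewrite rmorphN rmorph1 mulrN1.
Qed.

Ltac is_der_auto := lazymatch goal with
  | |- is_wirt _ _ _ _ (fun p => @?F p + @?G p) _ =>
    refine (@is_wirtD R al be ga A F G _ _ _ _); is_der_auto
  | |- is_wirt _ _ _ _ (fun p => - @?F p) _ =>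
    refine (@is_wirtN R al be ga A oA F _ _); is_der_auto
  | |- is_wirt _ _ _ _ (fun p => @?F p ^+ ?n) _ =>
    refine (@is_wirtX R al be ga A oA F _ n _); is_der_auto
  | |- is_wirt _ _ _ _ (fun p => @?F p * @?G p) _ =>
    refine (@is_wirtM R al be ga A F G _ _ _ _); is_der_auto
  | |- is_wirt _ _ _ _ (fun p => zc p) _ => exact is_der_zc
  | |- is_wirt _ _ _ _ (fun p => (zc p)^*) _ => exact is_der_zbar
  | |- is_wirt _ _ _ _ (fun p => (C - p.2)%:C) _ => exact is_der_s
  | |- is_wirt _ _ _ _ (fun p => ?c) _ => exact (@is_wirt_cst R al be ga A c)
  end.

(** [a], [b], [c] are the values of the derivation on z, zbar and C - t, so one computation serves
    dz at (1, 0, 0), dzbar at (0, 1, 0) and dt at (0, 0, -1). The coefficient of [b] comes from the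
    symmetry of Q in z and zbar. *)
Lemma is_der_pQ : is_der (fun p => pQ (Z p) (W p) (S p))
  (fun p => a * pQ1 (Z p) (W p) (S p) + b * pQ1 (W p) (Z p) (S p)
     - c * (W p - Z p ^+ 3 / 3 - S p + (Z p - W p ^+ 3 / 3 - S p))).
Proof.
rewrite /pQ /pQ1; eapply is_wirt_eq; first is_der_auto.
by move=> p _ /=; move: (zc p) (zc p)^* (S p) => z w s; field.
Qed.

Lemma is_der_pQ1 : is_der (fun p => pQ1 (Z p) (W p) (S p))
  (fun p => a * pQ2 (Z p) (W p) (S p)
     + b * (2 * (Z p * W p) + (Z p * W p) ^+ 2 + 1) + c * (Z p ^+ 2 - 1)).
Proof.
rewrite /pQ1 /pQ2; eapply is_wirt_eq; first is_der_auto.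
by move=> p _ /=; move: (zc p) (zc p)^* (S p) => z w s; field.
Qed.

Lemma is_der_pQ2 : is_der (fun p => pQ2 (Z p) (W p) (S p))
  (fun p => a * pQ3 (Z p) (W p) (S p)
     + b * (2 * W p + 2 * Z p * W p ^+ 2) + c * (2 * Z p)).
Proof.
rewrite /pQ2 /pQ3; eapply is_wirt_eq; first is_der_auto.
by move=> p _ /=; move: (zc p) (zc p)^* (S p) => z w s; field.
Qed.

Lemma is_der_pn : is_der (fun p => pn (Z p) (W p) (S p))
  (fun p => a * pn1 (Z p) (W p) (S p) + b * pn1 (W p) (Z p) (S p) + c * (Z p + W p)).
Proof.
rewrite /pn /pn1; eapply is_wirt_eq; first is_der_auto.
by move=> p _ /=; move: (zc p) (zc p)^* (S p) => z w s; field.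
Qed.

Lemma is_der_pn1 : is_der (fun p => pn1 (Z p) (W p) (S p))
  (fun p => a * pn2 (Z p) (W p) - b * ((Z p ^+ 2 + W p ^+ 2) / 2) + c).
Proof.
rewrite /pn1 /pn2; eapply is_wirt_eq; first is_der_auto.
by move=> p _ /=; move: (zc p) (zc p)^* (S p) => z w s; field.
Qed.

Lemma is_der_pn2 : is_der (fun p => pn2 (Z p) (W p))
  (fun p => - (a * W p + b * Z p)).
Proof.
rewrite /pn2; eapply is_wirt_eq; first is_der_auto.
by move=> p _ /=; move: (zc p) (zc p)^* (S p) => z w s; field.
Qed.

End Derivation.
End PDE.

Section Conjugation.
Variable R : realType.
Implicit Types (F : R * R * R -> R[i]) (p v : R * R * R).

Lemma conj_rhs (a b v u d : R[i]) :
  (a + 3 * b * v + 3 / 2 * u * d)^* = a^* + 3 * b^* * v^* + 3 / 2 * u^* * d^*.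
Proof.
by rewrite !(rmorphD, rmorphM, fmorphV, rmorph1).
Qed.

Lemma cderiv_conj F p v (d : R[i]) : cderiv F p v d -> cderiv (fun q => (F q)^*) p v d^*.
Proof.
move=> [F1 F2]; have F2' := is_deriveN F2.
split; [move: F1 {F2 F2'}|move: F2' {F1 F2}]; congr (is_derive p v _ _);
  first [by case: d | by apply/funext => q; rewrite ?fctE; case: (F q)].
Qed.

Lemma dz_wirt F p : dz F p = wirt 2^-1 (- (2^-1 * 'i)) 0 F p.
Proof.
rewrite /dz /wirt; move: (partial ex F p) (partial ey F p) (partial et F p) => *; ring.
Qed.

Lemma dzbar_wirt F p : dzbar F p = wirt 2^-1 (2^-1 * 'i) 0 F p.
Proof.
rewrite /dzbar /wirt; move: (partial ex F p) (partial ey F p) (partial et F p) => *; ring.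
Qed.

Lemma dt_wirt F p : dt F p = wirt 0 0 1 F p.
Proof.
rewrite /dt /wirt; move: (partial ex F p) (partial ey F p) (partial et F p) => *; ring.
Qed.

Lemma dzbar_conj F p : cderivable F p -> dzbar (fun q => (F q)^*) p = (dz F p)^*.
Proof.
move=> /cderivableP dF; rewrite /dzbar /dz.
rewrite !(cderiv_partial (cderiv_conj (dF _))).
rewrite (real_complex_inv_nat _ 2) imaginaryE.
by case: (partial ex F p) => ? ?; case: (partial ey F p) => ? ?; simpc => /=; congr (_ +i* _); ring.
Qed.

End Conjugation.

(** * The two equations of the system *)

Section NovikovVeselov.
Variables (R : realType) (C : R).
Let A : set (R * R * R) := [set p | p != sing C].
Let oA : open A := @open_neq_sing R C.
Local Notation Z p := (zc p).
Local Notation W p := ((zc p)^*).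
Local Notation S p := ((C - p.2)%:C).
Local Notation is_dz := (is_wirt (2^-1 : R[i]) (- (2^-1 * 'i)) 0 A).
Local Notation is_dzbar := (is_wirt (2^-1 : R[i]) (2^-1 * 'i) 0 A).
Local Notation is_dt := (is_wirt (0 : R[i]) 0 1 A).
Let q p := pQ (Z p) (W p) (S p).
Let q1 p := pQ1 (Z p) (W p) (S p).
Let q2 p := pQ2 (Z p) (W p) (S p).
Let q3 p := pQ3 (Z p) (W p) (S p).
Let n p := pn (Z p) (W p) (S p).
Let n1 p := pn1 (Z p) (W p) (S p).
Let n2 (p : R * R * R) := pn2 (Z p) (W p).
Let n3 (p : R * R * R) : R[i] := - W p.

Lemma pQ_neq0 p : A p -> q p != 0.
Proof.
move=> Ap; rewrite /q pQ_zc; have := rden_neq0 Ap; apply: contra => /eqP[/eqP].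
by [].
Qed.

Let i2 : 'i * 'i = -1 :> R[i]. Proof. by rewrite -expr2 sqrCi. Qed.

(** Values of the derivations on z and zbar: (1, 0) for dz, (0, 1) for dzbar, (0, 0) for dt. [c0]
    says that dz and dzbar annihilate C - t. *)
Let az : 2^-1 + (- (2^-1 * 'i)) * 'i = 1 :> R[i].
Proof. by rewrite mulNr -mulrA i2 mulrN1 opprK; field. Qed.
Let bz : 2^-1 - (- (2^-1 * 'i)) * 'i = 0 :> R[i].
Proof. by rewrite mulNr -mulrA i2 mulrN1 opprK subrr. Qed.
Let aw : 2^-1 + 2^-1 * 'i * 'i = 0 :> R[i].
Proof. by rewrite -mulrA i2 mulrN1 subrr. Qed.
Let bw : 2^-1 - 2^-1 * 'i * 'i = 1 :> R[i].
Proof. by rewrite -mulrA i2 mulrN1 opprK; field. Qed.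
Let at_ : 0 + 0 * 'i = 0 :> R[i]. Proof. by rewrite mul0r addr0. Qed.
Let bt : 0 - 0 * 'i = 0 :> R[i]. Proof. by rewrite mul0r subr0. Qed.
Let c0 : - 0 = 0 :> R[i]. Proof. exact: oppr0. Qed.

Let dzq : is_dz q q1.
Proof.
by apply: is_wirt_eq (is_der_pQ (C := C) az bz c0) _ => p _; rewrite mul1r !mul0r addr0 subr0.
Qed.
Let dzq1 : is_dz q1 q2.
Proof.
by apply: is_wirt_eq (is_der_pQ1 az bz c0) _ => p _; rewrite mul1r !mul0r !addr0.
Qed.
Let dzq2 : is_dz q2 q3.
Proof.
by apply: is_wirt_eq (is_der_pQ2 az bz c0) _ => p _; rewrite mul1r !mul0r !addr0.
Qed.
Let dzn : is_dz n n1.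
Proof.
by apply: is_wirt_eq (is_der_pn az bz c0) _ => p _; rewrite mul1r !mul0r !addr0.
Qed.
Let dzn1 : is_dz n1 n2.
Proof.
by apply: is_wirt_eq (is_der_pn1 az bz c0) _ => p _; rewrite mul1r !mul0r subr0 !addr0.
Qed.
Let dzn2 : is_dz n2 n3.
Proof.
by apply: is_wirt_eq (is_der_pn2 0 az bz) _ => p _; rewrite mul1r !mul0r addr0.
Qed.

Let UE p : Ut C p = n p / q p.
Proof. by rewrite UtE /n /q pn_zc pQ_zc real_complex_div. Qed.
Let VE p : Vt C p = q2 p / q p - (q1 p / q p) ^+ 2.
Proof. by rewrite VtE. Qed.

Let conj_Ut p : (Ut C p)^* = Ut C p.
Proof. by rewrite UtE; simpc. Qed.

Let is_dz_Ut := eq_is_wirt oA (is_der_quot1 oA pQ_neq0 dzn dzq) (fun p _ => esym (UE p)).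
Let is_dz_Vt := eq_is_wirt oA (is_der_log2 oA pQ_neq0 dzq dzq1 dzq2) (fun p _ => esym (VE p)).

Let dzU1 p : A p -> dz (Ut C) p = n1 p / q p - n p * q1 p * (q p)^-1 ^+ 2.
Proof. by move=> Ap; rewrite dz_wirt (wirtE is_dz_Ut). Qed.

Let is_dz_Ut2 := eq_is_wirt oA (is_der_quot2 oA pQ_neq0 dzn dzn1 dzq dzq1)
  (fun p Ap => esym (dzU1 Ap)).

Let dzU2 p : A p -> dz (dz (Ut C)) p = n2 p / q p
  - (2 * n1 p * q1 p + n p * q2 p) * (q p)^-1 ^+ 2
     + 2 * n p * q1 p ^+ 2 * (q p)^-1 ^+ 3.
Proof. by move=> Ap; rewrite dz_wirt (wirtE is_dz_Ut2). Qed.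

Let is_dz_Ut3 := eq_is_wirt oA (is_der_quot3 oA pQ_neq0 dzn dzn1 dzn2 dzq dzq1 dzq2)
  (fun p Ap => esym (dzU2 Ap)).

Let eq_dzbar F G p : (forall r, A r -> F r = G r) -> A p -> dzbar F p = dzbar G p.
Proof. by move=> FG Ap; rewrite !dzbar_wirt; exact: (eq_wirt _ _ _ oA FG Ap). Qed.

Let dzbarU1 p : A p -> dzbar (Ut C) p = (dz (Ut C) p)^*.
Proof.
move=> Ap; rewrite -dzbar_conj; last by have [] := is_dz_Ut Ap.
by apply: eq_dzbar => // r _; rewrite conj_Ut.
Qed.

Let dzbarU2 p : A p -> dzbar (dzbar (Ut C)) p = (dz (dz (Ut C)) p)^*.
Proof.
move=> Ap; rewrite -dzbar_conj; last by have [] := is_dz_Ut2 Ap.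
by apply: eq_dzbar => // r; exact: dzbarU1.
Qed.

Let dzbarU3 p : A p -> dzbar (dzbar (dzbar (Ut C))) p = (dz (dz (dz (Ut C))) p)^*.
Proof.
move=> Ap; rewrite -dzbar_conj; last by have [] := is_dz_Ut3 Ap.
by apply: eq_dzbar => // r; exact: dzbarU2.
Qed.

Let X p := pX (Z p) (W p) (S p).

Let XE p : A p -> dz (dz (dz (Ut C))) p + 3 * dz (Ut C) p * Vt C p
  + 3 / 2 * Ut C p * dz (Vt C) p = X p / q p ^+ 3.
Proof.
move=> Ap; rewrite dzU1// VE UE !dz_wirt (wirtE is_dz_Vt)// (wirtE is_dz_Ut3)//.
have -> : X p = n3 p * q p ^+ 2 - 3 * n2 p * q1 p * q p + 3 * n1 p * q1 p ^+ 2
  + n p * (q3 p * q p / 2 - 3 / 2 * q1 p * q2 p) by [].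
have := pQ_neq0 Ap; move: (n p) (n1 p) (n2 p) (n3 p) (q p) (q1 p) (q2 p) (q3 p).
by move=> a a1 a2 a3 b b1 b2 b3 b0; field.
Qed.

Let conj_X p : (X p)^* = pX (W p) (Z p) (S p).
Proof.
have cS : (S p)^* = S p by simpc.
apply: etrans (rmorph_pX (conjc : {rmorphism R[i] -> R[i]}) _ _ _) _.
by rewrite -[in RHS]cS -[in X in _ = pX _ X _](conjcK (Z p)).
Qed.

Let is_dt_Ut : is_dt (Ut C) (fun p => - (Z p + W p) / q p
  - n p * (W p - Z p ^+ 3 / 3 - S p + (Z p - W p ^+ 3 / 3 - S p)) * (q p)^-1 ^+ 2).
Proof.
have hn : is_dt n (fun p => - (Z p + W p)).
  apply: is_wirt_eq (is_der_pn at_ bt erefl) _ => p _.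
  by rewrite !mul0r !add0r mulN1r.
have hq : is_dt q (fun p => W p - Z p ^+ 3 / 3 - S p + (Z p - W p ^+ 3 / 3 - S p)).
  apply: is_wirt_eq (is_der_pQ at_ bt erefl) _ => p _.
  by rewrite !mul0r !add0r mulN1r opprK.
have h := is_der_quot1 oA pQ_neq0 hn hq.
refine (eq_is_wirt oA h (fun p _ => esym (UE p))).
Qed.

Lemma Ut_evolution p : A p -> dt (Ut C) p =
  (dz (dz (dz (Ut C))) p + 3 * dz (Ut C) p * Vt C p + 3 / 2 * Ut C p * dz (Vt C) p)
  + (dzbar (dzbar (dzbar (Ut C))) p + 3 * dzbar (Ut C) p * (Vt C p)^*
     + 3 / 2 * Ut C p * dzbar (fun r => (Vt C r)^*) p).
Proof.
move=> Ap; rewrite XE// dzbarU3// dzbarU1// dzbar_conj; last by have [] := is_dz_Vt Ap.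
rewrite [X in _ = _ + X](_ : _ = (X p / q p ^+ 3)^*); last first.
  by rewrite -XE// conj_rhs !conjE conj_Ut.
have qV : ((q p)^-1)^* = (q p)^-1.
  by rewrite /q pQ_zc -(fmorphV (real_complex R)) /=; simpc.
rewrite [X in _ = _ + X](_ : _ = pX (W p) (Z p) (S p) / q p ^+ 3); last first.
  rewrite -conj_X -exprVn; move: (X p) => x.
  by rewrite -{2}qV; exact: (etrans (rmorphM (@conjc R) _ _) (congr1 _ (rmorphXn _ _ _))).
rewrite dt_wirt (wirtE is_dt_Ut)//.
have := pQ_neq0 Ap; rewrite /X /n /q.
(* The relation w = zbar is dropped here: the identity holds for independent z, w, s with Q
   nonzero. *)
move: (Z p) (W p) (S p) => z w s qq0.
rewrite -mulrDl; apply: (mulIf (expf_neq0 3 qq0)).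
rewrite mulfVK ?expf_neq0//.
move: qq0; rewrite /pX (_ : pQ w z s = pQ z w s); last by rewrite /pQ; ring.
set qq := pQ z w s => qq0.
(* This is U_t Q^3 = (n_t Q - n Q_t) Q. *)
transitivity (- (z + w) * qq ^+ 2 - pn z w s * (w - z ^+ 3 / 3 - s + (z - w ^+ 3 / 3 - s)) * qq).
  by field.
by rewrite /qq /pQ /pn /pn1 /pn2 /pQ1 /pQ2 /pQ3; field.
Qed.

(** Both sides are d_z^2 d_zbar (log Q); the equality is checked directly, after multiplication by
    Q^3. *)
Lemma Vt_constraint p : A p -> dzbar (Vt C) p = dz (fun r => Ut C r ^+ 2) p.
Proof.
move=> Ap.
have hq : is_dzbar q (fun p => pQ1 (W p) (Z p) (S p)).
  apply: is_wirt_eq (is_der_pQ aw bw c0) _ => r _.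
  by rewrite !mul0r subr0 add0r mul1r.
have hq1 : is_dzbar q1 (fun p => 2 * (Z p * W p) + (Z p * W p) ^+ 2 + 1).
  apply: is_wirt_eq (is_der_pQ1 aw bw c0) _ => r _.
  by rewrite !mul0r addr0 add0r mul1r.
have hq2 : is_dzbar q2 (fun p => 2 * W p + 2 * Z p * W p ^+ 2).
  apply: is_wirt_eq (is_der_pQ2 aw bw c0) _ => r _.
  by rewrite !mul0r addr0 add0r mul1r.
have hqV := is_wirtV oA hq pQ_neq0.
have hV : is_dzbar (Vt C) (fun p => (2 * W p + 2 * Z p * W p ^+ 2) / q p
    - q2 p * pQ1 (W p) (Z p) (S p) * (q p)^-1 ^+ 2
    - 2 * (q1 p / q p) * ((2 * (Z p * W p) + (Z p * W p) ^+ 2 + 1) / q p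
       - q1 p * pQ1 (W p) (Z p) (S p) * (q p)^-1 ^+ 2)).
  have h := is_wirtD (is_wirtM hq2 hqV) (is_wirtN oA (is_wirtX oA 2 (is_wirtM hq1 hqV))).
  have h' := eq_is_wirt oA h (fun r _ => esym (VE r)).
  apply: is_wirt_eq h' _ => r _ /=.
  move: (q r)^-1 (q2 r) (q1 r) (Z r) (W r) (S r) => *; ring.
rewrite dzbar_wirt (wirtE hV)// dz_wirt (wirtE (is_wirtX oA 2 is_dz_Ut))// UE.
cbv beta; rewrite -[(2.-1)%N]/(1%N) expr1.
have := pQ_neq0 Ap; rewrite /n /n1 /q1 /q2 /q.
move: (Z p) (W p) (S p) => z w s qq0.
apply: (mulIf (expf_neq0 3 qq0)).
move: qq0; set qq := pQ z w s => qq0.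
transitivity ((2 * w + 2 * z * w ^+ 2) * qq ^+ 2 - pQ2 z w s * pQ1 w z s * qq
   - 2 * pQ1 z w s * ((2 * (z * w) + (z * w) ^+ 2 + 1) * qq - pQ1 z w s * pQ1 w z s)).
  by field.
transitivity (2 * pn z w s * (pn1 z w s * qq - pn z w s * pQ1 z w s)); last by field.
by rewrite /qq /pQ /pn /pn1 /pQ1 /pQ2; field.
Qed.

Lemma mNV_solution_Ut_Vt : mNV_solution A (Ut C) (Vt C).
Proof.
split; [exact: class_Cc_Ut|exact: class_Cc_Vt|].
move=> p Ap; split; [exact: Ut_evolution|exact: Vt_constraint].
Qed.

End NovikovVeselov.

(** * Decay and the singular point *)

Section Decay.
Variable R : realType.
Implicit Types x y s r : R.

(** Grouping by powers of r^2 = x^2 + y^2 shows the two regimes: r^6 / 9 governs Q at infinity and,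
    for s = 0, r^2 governs it at the origin. *)
Lemma rdenE x y s : rden x y s =
  (x ^+ 2 + y ^+ 2) + (x ^+ 2 + y ^+ 2) ^+ 2 / 3 + (x ^+ 2 + y ^+ 2) ^+ 3 / 9
  + 4 / 3 * (x * y) ^+ 2 + s ^+ 2 - 2 * s * (x * (1 - x ^+ 2 / 3 + y ^+ 2)).
Proof. by rewrite /rden; field. Qed.

Lemma abs_le_radius x y r : 0 <= r -> x ^+ 2 + y ^+ 2 = r ^+ 2 -> `|x| <= r.
Proof.
move=> r0 e; rewrite -(@ler_pXn2r _ 2) ?nnegrE// real_normK ?num_real//.
by rewrite -e lerDl sqr_ge0.
Qed.

(** The only possibly negative term of [rdenE] is at most 4 |s| r^3 in modulus, hence at most r^6 /
    18, half of r^6 / 9, once r^3 >= 72 |s|. This is the origin of the threshold. *)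
Lemma rden_lower x y s r : 1 + 72 * `|s| <= r -> x ^+ 2 + y ^+ 2 = r ^+ 2 ->
  r ^+ 6 / 18 <= rden x y s.
Proof.
move=> rs e; have s0 := normr_ge0 s.
have r1 : 1 <= r by lra.
have xr : `|x| <= r by apply: abs_le_radius e; lra.
have b : `|x * (1 - x ^+ 2 / 3 + y ^+ 2)| <= r * (2 * r ^+ 2).
  rewrite normrM ler_pM// ler_norml.
  have := sqr_ge0 x; have := sqr_ge0 y; have : 1 <= r ^+ 2 by rewrite expr_ge1//; lra.
  by move=> *; apply/andP; split; lra.
have b' : s * (x * (1 - x ^+ 2 / 3 + y ^+ 2)) <= `|s| * (r * (2 * r ^+ 2)).
  by apply: (le_trans (ler_norm _)); rewrite normrM ler_wpM2l.
have r3 : r <= r ^+ 3 by rewrite ler_eXnr//; lra.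
have c : 72 * `|s| * r ^+ 3 <= r ^+ 3 * r ^+ 3.
  by apply: ler_wpM2r; [rewrite exprn_ge0; lra|lra].
rewrite rdenE e -!exprM.
have := sqr_ge0 s; have := sqr_ge0 (x * y); have := sqr_ge0 r; have := sqr_ge0 (r ^+ 2).
rewrite -exprM -exprD in c *.
move: b' c; rewrite -[(2 * 3)%N]/6%N -[(3 + 3)%N]/6%N -[(2 * 2)%N]/4%N.
rewrite (_ : r * (2 * r ^+ 2) = 2 * r ^+ 3); last by ring.
rewrite mulrCA -mulrA => *; lra.
Qed.

Lemma rnum_upper x y s r : 1 + 72 * `|s| <= r -> x ^+ 2 + y ^+ 2 = r ^+ 2 ->
  `|rnum x y s| <= 4 * r ^+ 4.
Proof.
move=> rs e; have s0 := normr_ge0 s.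
have r1 : 1 <= r by lra.
have xr : `|x| <= r by apply: abs_le_radius e; lra.
have sx : `|s * x| <= r * r by rewrite normrM ler_pM//; lra.
have g : `|x ^+ 2 - y ^+ 2| <= r ^+ 2.
  by rewrite ler_norml; have := sqr_ge0 x; have := sqr_ge0 y => *; apply/andP; split; lra.
have g' : `|(x ^+ 2 - y ^+ 2) * (1 + (x ^+ 2 + y ^+ 2) / 3)| <= r ^+ 2 * (1 + r ^+ 2 / 3).
  have p : 0 <= 1 + r ^+ 2 / 3 by rewrite addr_ge0 ?divr_ge0 ?sqr_ge0.
  by rewrite e normrM (ger0_norm p) ler_wpM2r.
have r24 : r ^+ 2 <= r ^+ 4 by rewrite ler_weXn2l.
rewrite /rnum -mulrA (le_trans (ler_normB _ _))// normrM normr_nat.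
have r4 : r ^+ 2 * (1 + r ^+ 2 / 3) = r ^+ 2 + r ^+ 4 / 3 by field.
have r4_0 : 0 <= r ^+ 4 by rewrite exprn_ge0; lra.
by move: g' sx; rewrite r4 -expr2; lra.
Qed.

Lemma normc_real r : `|r%:C| = `|r|%:C.
Proof. by rewrite normc_def /= expr0n addr0 sqrtr_sqr. Qed.

Lemma normc_radius x y r : 0 <= r -> Num.sqrt (x ^+ 2 + y ^+ 2) = r ->
  `|x +i* y| = r%:C.
Proof. by move=> r0 <-; rewrite normc_def. Qed.

Lemma quadratic_decay_intro (f : R -> R -> R[i]) (M r0 : R) :
  (forall x y r, r0 <= r -> 0 < r -> Num.sqrt (x ^+ 2 + y ^+ 2) = r ->
     x ^+ 2 + y ^+ 2 = r ^+ 2 -> `|f x y| <= (M / r ^+ 2)%:C) ->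
  quadratic_decay f.
Proof.
move=> h; exists M; near=> r => x y e.
have r_gt0 : 0 < r by near: r; exact: nbhs_pinfty_gt.
have r_ge : r0 <= r by near: r; apply: nbhs_pinfty_ge; rewrite num_real.
apply: h => //.
by rewrite -e sqr_sqrtr// addr_ge0 ?sqr_ge0.
Unshelve. all: by end_near. Qed.

Lemma normcB_le (u v : R[i]) (a b c : R) : `|u| <= a%:C -> `|v| <= b%:C -> a + b <= c ->
  `|u - v| <= c%:C.
Proof.
move=> ua vb abc; rewrite (le_trans (ler_normB _ _))// (le_trans (lerD ua vb))//.
by rewrite -rmorphD lecR.
Qed.

Lemma normcD_le (u v : R[i]) (a b c : R) : `|u| <= a%:C -> `|v| <= b%:C -> a + b <= c ->
  `|u + v| <= c%:C.
Proof. by move=> ua vb; rewrite -(opprK v); apply: normcB_le; rewrite ?normrN. Qed.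

Lemma normcM_le (u v : R[i]) (a b c : R) : `|u| <= a%:C -> `|v| <= b%:C -> a * b <= c ->
  `|u * v| <= c%:C.
Proof.
move=> ua vb abc; rewrite normrM (le_trans (ler_pM _ _ ua vb))//.
by rewrite -rmorphM lecR.
Qed.

Lemma normcX_le n (u : R[i]) (a : R) : `|u| <= a%:C -> `|u ^+ n| <= (a ^+ n)%:C.
Proof. by move=> ua; rewrite normrX rmorphXn lerXn2r// nnegrE (le_trans _ ua). Qed.

Variable C : R.

Lemma decay_Ut t : quadratic_decay (fun x y => Ut C (x, y, t)).
Proof.
(* The decay constant 72 = 4 * 18 is 4 r^4 over r^6 / 18, times r^2. *)
apply: (@quadratic_decay_intro _ 72 (1 + 72 * `|C - t|)) => x y r rs r0 _ e.
rewrite UtE/= normc_real lecR normrM normfV.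
have l := rden_lower rs e; have u := rnum_upper rs e.
have r6 : 0 < r ^+ 6 by rewrite exprn_gt0.
have d0 : 0 < rden x y (C - t) by apply: lt_le_trans l; rewrite divr_gt0.
rewrite (gtr0_norm d0) ler_pdivrMr// mulrAC ler_pdivlMr ?exprn_gt0//.
apply: le_trans (_ : 4 * r ^+ 4 * r ^+ 2 <= _); first by rewrite ler_wpM2r// exprn_ge0// ltW.
rewrite -mulrA -exprD -[(4 + 2)%N]/6%N; lra.
Qed.

Lemma decay_Vt t : quadratic_decay (fun x y => Vt C (x, y, t)).
Proof.
(* Here |Q_zz| <= 7 r^4, |Q_z| <= 7 r^5 and |1 / Q| <= 18 / r^6, and 126 = 7 * 18. *)
apply: (@quadratic_decay_intro _ (126 + 126 ^+ 2) (1 + 72 * `|C - t|)) => x y r rs r0 er e.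
rewrite VtE /zc /=; set z := x +i* y; set w := x -i* y; set s := (C - t)%:C.
have s0 := normr_ge0 (C - t).
have r1 : 1 <= r by lra.
have l := rden_lower rs e.
have r6 : 0 < r ^+ 6 by rewrite exprn_gt0.
have d0 : 0 < rden x y (C - t) by apply: lt_le_trans l; rewrite divr_gt0.
have nz : `|z| = r%:C by apply: normc_radius => //; exact: ltW.
have nw : `|w| = r%:C by apply: normc_radius; rewrite ?sqrrN//; exact: ltW.
have ns : `|s| <= r%:C by rewrite normc_real lecR; lra.
have n3 : `|3^-1 : R[i]| <= (3^-1)%:C.
  by rewrite normfV normr_nat (real_complex_inv_nat _ 3).
have n2 : `|2 : R[i]| <= 2%:C by rewrite normr_nat (rmorph_nat (real_complex R)).
have nF (a b : R[i]) : `|a| <= r%:C -> `|b| <= r%:C ->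
    `|a - b ^+ 3 / 3 - s| <= (2 * r + r ^+ 3 / 3)%:C.
  move=> na nb; have nb3 := normcM_le (normcX_le 3 nb) n3 (lexx _).
  apply: (normcB_le (normcB_le na nb3 (lexx _)) ns).
  lra.
have {nz}nz : `|z| <= r%:C by rewrite nz.
have {nw}nw : `|w| <= r%:C by rewrite nw.
have zF := nF _ _ nz nw; have wF := nF _ _ nw nz.
have r35 : r ^+ 3 <= r ^+ 5 by rewrite ler_weXn2l.
have r15 : r <= r ^+ 5 by rewrite ler_eXnr.
have r24 : r ^+ 2 <= r ^+ 4 by rewrite ler_weXn2l.
have r4_0 : 0 <= r ^+ 4 by rewrite exprn_ge0// ltW.
have zw2 := normcD_le (normcX_le 2 nz) (normcX_le 2 nw) (lexx _).
have b1 : `|pQ1 z w s| <= (7 * r ^+ 5)%:C.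
  apply: (normcD_le (normcB_le (normcM_le zw2 nz (lexx _))
    (normcM_le (normcX_le 2 nz) zF (lexx _)) (lexx _)) wF).
  rewrite [X in X <= _](_ : _ = 4 * r ^+ 3 + r ^+ 5 / 3 + 2 * r + r ^+ 3 / 3); last by field.
  lra.
have b2 : `|pQ2 z w s| <= (7 * r ^+ 4)%:C.
  apply: (normcB_le zw2 (normcM_le (normcM_le n2 nz (lexx _)) zF (lexx _))).
  rewrite [X in X <= _](_ : _ = 6 * r ^+ 2 + 2 / 3 * r ^+ 4); last by field.
  lra.
have bq : `|(pQ z w s)^-1| <= (18 / r ^+ 6)%:C.
  rewrite -rden_pQ -(fmorphV (real_complex R)) normc_real lecR normfV gtr0_norm//.
  by rewrite invf_ple ?posrE ?divr_gt0// invf_div.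
have b3 := normcM_le b1 bq (lexx _); have b4 := normcM_le b2 bq (lexx _).
apply: (normcB_le b4 (normcX_le 2 b3)).
have r2 : 0 < r ^+ 2 by rewrite exprn_gt0.
rewrite le_eqVlt; apply/orP; left; apply/eqP; field; lra.
Qed.

End Decay.

(** * Limits along rays into the singular point *)

Section Singularity.
Variables (R : realType) (C : R).
Implicit Types (r phi l : R).

Lemma cvg_real_complex (T : Type) (F : set_system T) {FF : Filter F} (f : T -> R) l :
  f @ F --> l -> (fun t => (f t)%:C : R[i]^o) @ F --> (l%:C : R[i]^o).
Proof.
move=> fl; apply/cvgrPdist_lt => -[e e'] /=; rewrite ltcE /= => /andP[/eqP e'0 e0].
move/cvgrPdist_lt : fl => /(_ e e0); apply: filterS => t h.
rewrite -rmorphB normc_real.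
by rewrite ltcE /= -e'0 eqxx.
Qed.

Lemma cvg_complex_Re (T : Type) (F : set_system T) {FF : Filter F} (f : T -> R[i]) (l : R[i]) :
  (fun t => f t : R[i]^o) @ F --> (l : R[i]^o) ->
  (fun t => complex.Re (f t)) @ F --> complex.Re l.
Proof.
move=> fl; apply/cvgrPdist_lt => e e0.
have e0' : 0 < e%:C :> R[i] by rewrite ltcR.
move/cvgrPdist_lt : fl => /(_ _ e0'); apply: filterS => t h.
by rewrite -ltcR (le_lt_trans _ h)// -raddfB normc_ge_Re.
Qed.

(** A rational function of r is read as a function of the first coordinate of space-time, so that
    its limit at 0 is an instance of [ratfun_continuous]. *)
Lemma cvg_ratfun_line (F : R * R * R -> R) : ratfun setT F ->
  F (r, 0, 0) @[r --> 0^'+] --> F (0, 0, 0).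
Proof.
move=> rF; have cF := ratfun_continuous openT rF (I : setT (0, 0, 0)).
apply: cvg_at_right_filter.
have c : (r, 0, 0) @[r --> (0 : R)] --> ((0, 0, 0) : R * R * R).
  exact: (cvg_pair (cvg_pair cvg_id (cvg_cst (0 : R))) (cvg_cst (0 : R))).
exact: (cvg_comp _ _ c cF).
Qed.

Definition ray phi r : R * R * R := (r * cos phi, r * sin phi, C).

Lemma ray_cvg phi : ray phi r @[r --> 0^'+] --> (sing C)^'.
Proof.
have c : ray phi r @[r --> 0^'+] --> sing C.
  rewrite /ray /sing.
  have h (a : R) : r * a @[r --> 0^'+] --> 0.
    rewrite -[X in _ --> X](mul0r a); apply: cvgMl; apply: cvg_at_right_filter; exact: cvg_id.
  exact: (cvg_pair (cvg_pair (h (cos phi)) (h (sin phi))) (cvg_cst C)).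
move=> B; rewrite /dnbhs /within /= => /c; rewrite /= !near_simpl => hB.
near=> r.
have r0 : 0 < r by [].
have : sing C <> ray phi r.
  move=> [/esym/eqP h1 /esym/eqP h2].
  move: h1 h2; rewrite !mulf_eq0 (gt_eqF r0)/= => /eqP c0 /eqP s0.
  by have /eqP := cos2Dsin2 phi; rewrite c0 s0 expr0n addr0 eq_sym oner_eq0.
move=> /eqP ne; rewrite eq_sym in ne.
by move: ne; near: r.
Unshelve. all: by end_near. Qed.

Lemma cos_double phi : cos (2 * phi) = cos phi ^+ 2 - sin phi ^+ 2.
Proof. by rewrite mulr2n mulrDl mul1r cosD -!expr2. Qed.

Lemma Ut_ray phi : (Ut C (ray phi r) : R[i]^o) @[r --> 0^'+]
  --> ((- cos (2 * phi))%:C : R[i]^o).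
Proof.
(* On the ray Q = r^2 k(r), and n has the factor r^2 too; [f] is their quotient after cancellation
   and is continuous at 0. *)
pose k r := 1 + r ^+ 2 / 3 + r ^+ 4 / 9 + 4 / 3 * (r * cos phi * sin phi) ^+ 2.
pose f r := - cos (2 * phi) * (1 + r ^+ 2 / 3) / k r.
have kE r : k r != 0.
  rewrite gt_eqF// /k (exprM r 2 2); have := sqr_ge0 (r * cos phi * sin phi).
  by have := sqr_ge0 r; have := sqr_ge0 (r ^+ 2) => *; lra.
have fl : f r @[r --> 0^'+] --> - cos (2 * phi).
  have -> : - cos (2 * phi) = f 0.
    by rewrite /f /k !expr0n/= !mul0r !expr0n/= mulr0 !addr0 mulr1 divr1.
  have rF : ratfun setT (fun p : R * R * R =>
      - cos (2 * phi) * (1 + p.1.1 ^+ 2 / 3) * (k p.1.1)^-1).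
    apply: ratfunM; first by apply: polyfun_ratfun; polyfun_auto.
    apply: ratfunV => [|p _]; last exact: kE.
    by apply: polyfun_ratfun; rewrite /k; polyfun_auto.
  exact: (cvg_ratfun_line rF).
move/cvg_real_complex : fl; apply: cvg_trans; apply: near_eq_cvg.
near=> r; have r0 : 0 < r by [].
rewrite UtE /ray /= subrr; congr (_%:C).
have -> : rden (r * cos phi) (r * sin phi) 0 = r ^+ 2 * k r.
  rewrite rdenE /k !exprMn -!mulrDr cos2Dsin2 mulr1; ring.
have -> : rnum (r * cos phi) (r * sin phi) 0 = - r ^+ 2 * cos (2 * phi) * (1 + r ^+ 2 / 3).
  rewrite /rnum !exprMn -!mulrDr cos2Dsin2 mulr1 cos_double; ring.
by rewrite /f; field; rewrite kE gt_eqF.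
Unshelve. all: by end_near. Qed.

(** The rays at angles 0 and pi / 2 have the different limits -1 and 1. *)
Lemma not_extends_Ut : ~ extends_continuously (Ut C) (sing C).
Proof.
move=> [l Ul].
have lE phi : l = (- cos (2 * phi))%:C.
  apply: (cvg_unique (@norm_hausdorff _ R[i]^o) _ (@Ut_ray phi)).
  exact: cvg_comp (@ray_cvg phi) Ul.
have := lE 0; rewrite (lE (pi / 2)) mulr0 cos0 mulrCA mulfV// mulr1 cospi opprK.
by move=> [] /eqP; rewrite -subr_eq0 opprK -mulr2n mulrn_eq0 oner_eq0.
Qed.

(** V blows up like - r^-2 along the positive x-axis: r^2 V tends to -1 there, while a continuous
    extension would make it tend to 0. *)
Lemma not_extends_Vt : ~ extends_continuously (Vt C) (sing C).
Proof.
move=> [l Vl].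
have Vray : (Vt C (ray 0 r) : R[i]^o) @[r --> 0^'+] --> l := cvg_comp _ _ (@ray_cvg 0) Vl.
have r2 : r ^+ 2 @[r --> 0^'+] --> (0 : R).
  rewrite -[X in _ --> X](expr0n _ 2).
  by apply: cvg_at_right_filter; exact: exprn_continuous.
have p0 : r ^+ 2 * complex.Re (Vt C (ray 0 r)) @[r --> 0^'+] --> (0 : R).
  by rewrite -[X in _ --> X](mul0r (complex.Re l)); apply: cvgM r2 _; exact: cvg_complex_Re.
pose k r := 1 + r ^+ 2 / 3 + r ^+ 4 / 9.
have kE r : k r != 0.
  rewrite gt_eqF// /k (exprM r 2 2).
  by have := sqr_ge0 r; have := sqr_ge0 (r ^+ 2) => *; lra.
(* This is r^2 V on the ray, where Q = r^2 k(r), Q_zz = 2/3 r^4 and Q_z = r (1 + 2/3 r^2 + r^4 /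
   3). *)
pose f r := 2 / 3 * r ^+ 4 * (k r)^-1 - ((1 + 2 / 3 * r ^+ 2 + r ^+ 4 / 3) * (k r)^-1) ^+ 2.
have fl : f r @[r --> 0^'+] --> (-1 : R).
  have -> : -1 = f 0.
    by rewrite /f /k !expr0n/= !mul0r !mulr0 !mul0r !addr0 invr1 mulr1 expr1n sub0r.
  have rk : ratfun setT (fun p : R * R * R => (k p.1.1)^-1).
    apply: ratfunV => [|p _]; last exact: kE.
    by apply: polyfun_ratfun; rewrite /k; polyfun_auto.
  have rF : ratfun setT (fun p : R * R * R => 2 / 3 * p.1.1 ^+ 4 * (k p.1.1)^-1
      + - (((1 + 2 / 3 * p.1.1 ^+ 2 + p.1.1 ^+ 4 / 3) * (k p.1.1)^-1)
         * ((1 + 2 / 3 * p.1.1 ^+ 2 + p.1.1 ^+ 4 / 3) * (k p.1.1)^-1))).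
    apply: ratfunD; last apply: ratfunN; repeat (apply: ratfunM => //);
      by apply: polyfun_ratfun; polyfun_auto.
  exact: (cvg_ratfun_line rF).
have p1 : r ^+ 2 * complex.Re (Vt C (ray 0 r)) @[r --> 0^'+] --> (-1 : R).
  move: fl; apply: cvg_trans; apply: near_eq_cvg.
  near=> r; have r0 : 0 < r by [].
  have zr : zc (ray 0 r) = r%:C by rewrite /zc /ray /= sin0 cos0 mulr0 mulr1.
  rewrite VtE zr conjE conjc_real (subrr C).
  have r0' : r != 0 by rewrite gt_eqF.
  have -> : pV r%:C r%:C (0 : R)%:C = (f r / r ^+ 2)%:C.
    have -> : f r / r ^+ 2 = pV r r 0.
      rewrite /f /pV (_ : pQ r r 0 = r ^+ 2 * k r); last by rewrite /pQ /k; field.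
      by move: (kE r); rewrite /pQ1 /pQ2; move: (k r) => kr kr0; field; rewrite kr0.
    exact/esym/(rmorph_pV (real_complex R)).
  by rewrite [complex.Re _]/(f r / r ^+ 2) mulrC divfK// expf_neq0.
have e : (0 : R) = -1 by apply: (cvg_unique (@norm_hausdorff _ R^o) p0 p1).
by move/eqP: e; rewrite eq_sym oppr_eq0 oner_eq0.
Unshelve. all: by end_near. Qed.

End Singularity.

(** * Power series of rational functions *)

Section FormalSums.
Variable R : realType.
Local Notation expo := (nat * nat * nat)%type.
Local Notation fsum := (seq (R * expo)).
Implicit Types (l P u : fsum) (h : R * R * R) (x : expo) (m : R * expo).

Definition deg x := (x.1.1 + x.1.2 + x.2)%N.
Definition hpow h x := h.1.1 ^+ x.1.1 * h.1.2 ^+ x.1.2 * h.2 ^+ x.2.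
Definition xadd x y : expo := (x.1.1 + y.1.1, x.1.2 + y.1.2, x.2 + y.2)%N.

Lemma hpowD h x y : hpow h (xadd x y) = hpow h x * hpow h y.
Proof. by rewrite /hpow /= !exprD; ring. Qed.

Lemma hpow0 h : hpow h (0, 0, 0)%N = 1.
Proof. by rewrite /hpow /= !expr0 !mulr1. Qed.

Definition evalf l h := \sum_(m <- l) m.1 * hpow h m.2.
(** Exponents may repeat in a list, and absolute values are taken before like terms are collected.
    This makes [evala] exactly multiplicative and still a bound for the collected sums. *)
Definition evala l h := \sum_(m <- l) `|m.1 * hpow h m.2|.

Definition mulf l l' : fsum := [seq (m.1 * m'.1, xadd m.2 m'.2) | m <- l, m' <- l'].

Lemma evalfM l l' h : evalf (mulf l l') h = evalf l h * evalf l' h.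
Proof.
rewrite /evalf big_allpairs_dep /= big_distrlr /=.
by apply: eq_bigr => m _; apply: eq_bigr => m' _; rewrite hpowD mulrACA.
Qed.

Lemma evalaM l l' h : evala (mulf l l') h = evala l h * evala l' h.
Proof.
rewrite /evala big_allpairs_dep /= big_distrlr /=.
by apply: eq_bigr => m _; apply: eq_bigr => m' _; rewrite hpowD mulrACA normrM.
Qed.

Fixpoint powf u n : fsum := if n is n'.+1 then mulf u (powf u n') else [:: (1, (0, 0, 0)%N)].

Lemma evalfX u n h : evalf (powf u n) h = evalf u h ^+ n.
Proof.
elim: n => [|n IH] /=; first by rewrite /evalf big_seq1 /= hpow0 mulr1 expr0.
by rewrite evalfM IH exprS.
Qed.

Lemma evalaX u n h : evala (powf u n) h = evala u h ^+ n.
Proof.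
elim: n => [|n IH] /=; first by rewrite /evala big_seq1 /= hpow0 mulr1 normr1 expr0.
by rewrite evalaM IH exprS.
Qed.

Lemma evala_ge0 l h : 0 <= evala l h.
Proof. by apply: sumr_ge0. Qed.

Lemma evalf_le l h : `|evalf l h| <= evala l h.
Proof. exact: ler_norm_sum. Qed.

Definition coeff l x := \sum_(m <- l | m.2 == x) m.1.

Lemma sum_coeff l (s : seq expo) h : uniq s ->
  \sum_(x <- s) coeff l x * hpow h x = \sum_(m <- l | m.2 \in s) m.1 * hpow h m.2.
Proof.
move=> us; under eq_bigr do rewrite /coeff big_mkcond mulr_suml.
rewrite exchange_big /= [RHS]big_mkcond /=; apply: eq_bigr => m _.
case: ifPn => ms.
  rewrite (bigD1_seq m.2)//= eqxx big1 ?addr0// => x /negbTE.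
  by rewrite eq_sym => ->; rewrite mul0r.
rewrite big1_seq// => x /andP[_ xs]; case: eqP => [e|_]; last by rewrite mul0r.
by rewrite e xs in ms.
Qed.

(** Collecting like terms can only decrease the sum of absolute values: [sum_coeff] is applied to
    the list of absolute coefficients at the point of absolute coordinates. *)
Lemma sum_abs_coeff l (s : seq expo) h : uniq s ->
  \sum_(x <- s) `|coeff l x * hpow h x| <= evala l h.
Proof.
move=> us.
have hE x : hpow (`|h.1.1|, `|h.1.2|, `|h.2|) x = `|hpow h x|.
  by rewrite /hpow /= !normrM !normrX.
have le x : `|coeff l x * hpow h x| <=
    coeff [seq (`|m.1|, m.2) | m <- l] x * hpow (`|h.1.1|, `|h.1.2|, `|h.2|) x.
  by rewrite hE normrM ler_wpM2r// /coeff big_map; exact: ler_norm_sum.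
apply: (le_trans (ler_sum _ (fun x _ => le x))).
rewrite sum_coeff// big_map /evala /= big_mkcond; apply: ler_sum => m _.
case: ifPn => [_|_]; [by rewrite hE -normrM|by rewrite normr_ge0].
Qed.

Section Geometric.
Variables (P u : fsum) (D : nat).
Hypothesis u_deg : forall m, m \in u -> (0 < deg m.2)%N.
(** The exponents are bounded one by one, as suits partial sums over cubes. *)
Definition small_expo x := [&& x.1.1 < D, x.1.2 < D & x.2 < D]%N.
Hypothesis P_small : forall m, m \in P -> small_expo m.2.
Hypothesis u_small : forall m, m \in u -> small_expo m.2.

Definition geom n := mulf P (powf u n).

Lemma powf_deg n m : m \in powf u n -> (n <= deg m.2)%N.
Proof.
elim: n m => // n IH m /allpairsP[[m1 m2] /= [h1 h2 ->]] /=.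
have := u_deg h1; have := IH _ h2; rewrite /deg /=; lia.
Qed.

Lemma geom_deg n m : m \in geom n -> (n <= deg m.2)%N.
Proof.
move=> /allpairsP[[m1 m2] /= [h1 h2 ->]] /=.
by have := powf_deg h2; rewrite /deg /=; lia.
Qed.

Lemma coeff_geom0 n x : (deg x < n)%N -> coeff (geom n) x = 0.
Proof.
move=> xn; rewrite /coeff big1_seq// => m /andP[/eqP mx /geom_deg].
by rewrite mx leqNgt xn.
Qed.

Lemma powf_small n m : m \in powf u n ->
  [&& m.2.1.1 <= D * n, m.2.1.2 <= D * n & m.2.2 <= D * n]%N.
Proof.
elim: n m => [|n IH] m; first by rewrite inE => /eqP ->.
move=> /allpairsP[[m1 m2] /= [h1 h2 ->]] /=.
by have := u_small h1; have := IH _ h2; rewrite /small_expo; nia.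
Qed.

Lemma geom_small n m : m \in geom n ->
  [&& m.2.1.1 < D * n.+1, m.2.1.2 < D * n.+1 & m.2.2 < D * n.+1]%N.
Proof.
move=> /allpairsP[[m1 m2] /= [h1 h2 ->]] /=.
by have := P_small h1; have := powf_small h2; rewrite /small_expo; nia.
Qed.

(* Coefficient of [h ^ x] in [P / (1 - u) = \sum_n P u^n]; the sum may stop at the
   degree of [x] because [u] has no constant term. *)
Definition quot_coeff x := \sum_(n < (deg x).+1) coeff (geom n) x.

Lemma quot_coeffE M x : (deg x < M)%N -> quot_coeff x = \sum_(n < M) coeff (geom n) x.
Proof.
move=> xM; rewrite /quot_coeff -!(big_mkord xpredT (fun n => coeff (geom n) x)).
rewrite [RHS](@big_cat_nat _ _ _ (deg x).+1)//= [X in _ + X]big_nat_cond [X in _ + X]big1 ?addr0//.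
by move=> n /andP[/andP[h _] _]; rewrite coeff_geom0.
Qed.

Variable h : R * R * R.
Hypothesis u_half : evala u h <= 2^-1.

Lemma evala_geom n : evala (geom n) h <= evala P h * 2^-1 ^+ n.
Proof.
rewrite evalaM evalaX ler_wpM2l ?evala_ge0// lerXn2r// ?nnegrE ?evala_ge0//.
Qed.

Lemma sum_half n k : \sum_(n <= i < n + k) (2^-1 : R) ^+ i <= 2 * 2^-1 ^+ n.
Proof.
suff -> : \sum_(n <= i < n + k) (2^-1 : R) ^+ i = 2 * 2^-1 ^+ n - 2 * 2^-1 ^+ (n + k).
  by rewrite lerBlDr lerDl mulr_ge0// exprn_ge0.
elim: k => [|k IH]; first by rewrite addn0 big_geq// subrr.
by rewrite addnS big_nat_recr/= ?leq_addr// IH exprS; field.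
Qed.

(** The bound does not depend on the finite set [s], which is absolute convergence. With [M] above
    all degrees in [s], the sums over n have a common range and can be exchanged with the sum over
    [s]. *)
Lemma sum_abs_quot_coeff (s : seq expo) : uniq s ->
  \sum_(x <- s) `|quot_coeff x * hpow h x| <= 2 * evala P h.
Proof.
move=> us; pose M := (\max_(x <- s) deg x).+1.
have sM x : x \in s -> (deg x < M)%N.
  by move=> xs; rewrite ltnS (bigD1_seq x)//= leq_maxl.
have le x : x \in s -> `|quot_coeff x * hpow h x| <=
    \sum_(n < M) `|coeff (geom n) x * hpow h x|.
  by move=> /sM xM; rewrite (quot_coeffE xM) mulr_suml; exact: ler_norm_sum.
rewrite big_seq (le_trans (ler_sum _ le))// -big_seq exchange_big /=.
apply: (@le_trans _ _ (\sum_(n < M) evala P h * 2^-1 ^+ n)).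
  by apply: ler_sum => n _; apply: le_trans (evala_geom n); exact: sum_abs_coeff.
rewrite -mulr_sumr mulrC ler_wpM2r ?evala_ge0//.
have := sum_half 0 M; rewrite add0n expr0 mulr1; apply: le_trans.
by rewrite big_mkord.
Qed.

Definition cube N : seq expo :=
  [seq (ij.1, ij.2, k) | ij <- [seq (i, j) | i <- iota 0 N, j <- iota 0 N], k <- iota 0 N].

Lemma cube_uniq N : uniq (cube N).
Proof.
apply: allpairs_uniq; rewrite ?iota_uniq//.
- by apply: allpairs_uniq; rewrite ?iota_uniq// => -[? ?] [? ?].
- by move=> [[? ?] ?] [[? ?] ?] _ _ /= [-> -> ->].
Qed.

Lemma mem_cube N x : (x \in cube N) = [&& x.1.1 < N, x.1.2 < N & x.2 < N]%N.
Proof.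
case: x => [[i j] k]; apply/allpairsP/and3P => /=.
  move=> [[[a b] c] /= [/allpairsP[[a' b'] /= [ha hb [-> ->]]] hc [-> -> ->]]].
  by move: ha hb hc; rewrite !mem_iota.
move=> [hi hj hk]; exists (i, j, k) => /=; rewrite mem_iota hk; split => //.
by apply/allpairsP; exists (i, j); rewrite /= !mem_iota hi hj.
Qed.

Lemma sum_cube N (F : expo -> R) : \sum_(x <- cube N) F x =
  \sum_(i < N) \sum_(j < N) \sum_(k < N) F (i : nat, j : nat, k : nat).
Proof.
have sum_iota (G : nat -> R) : \sum_(i <- iota 0 N) G i = \sum_(i < N) G i.
  by rewrite -{1}(subn0 N) -/(index_iota 0 N) big_mkord.
rewrite big_allpairs_dep /= big_allpairs_dep /= sum_iota; apply: eq_bigr => i _.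
by rewrite sum_iota; apply: eq_bigr => j _; rewrite sum_iota.
Qed.

Lemma geom_sum (x : R) n : x != 1 -> \sum_(i < n) x ^+ i = (1 - x ^+ n) / (1 - x).
Proof.
move=> x1; have x1' : 1 - x != 0 by rewrite subr_eq0 eq_sym.
elim: n => [|n IH]; first by rewrite big_ord0 expr0 subrr mul0r.
by rewrite big_ord_recr /= IH exprS; field.
Qed.

Lemma evalf_neq1 : evalf u h != 1.
Proof.
apply/eqP => e; have := le_trans (evalf_le u h) u_half; rewrite e normr1.
by move=> ?; lra.
Qed.

Hypothesis D_gt0 : (0 < D)%N.

(** For n < N / D the whole of P u^n lies inside the cube and contributes exactly. The later n
    contribute at most a geometric tail, and truncating the geometric series costs as much again: 4
    = 2 + 2. *)
Lemma quot_cube_close N :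
  `|\sum_(x <- cube N) quot_coeff x * hpow h x - evalf P h / (1 - evalf u h)|
  <= 4 * evala P h * 2^-1 ^+ (N %/ D).
Proof.
(* The exponents of P u^n are below D (n + 1), which is at most N exactly when n < [n0]; [M] exceeds
   every degree in the cube. *)
set n0 := (N %/ D)%N; pose M := (3 * N + 1)%N.
have n0M : (n0 <= M)%N by rewrite /M /n0; have := leq_div N D; lia.
have cM x : x \in cube N -> (deg x < M)%N.
  by rewrite mem_cube /deg /M; lia.
pose c n := \sum_(m <- geom n | m.2 \in cube N) m.1 * hpow h m.2.
have -> : \sum_(x <- cube N) quot_coeff x * hpow h x = \sum_(0 <= n < M) c n.
  under eq_big_seq => x xc do rewrite (quot_coeffE (cM x xc)) mulr_suml.
  by rewrite exchange_big big_mkord /=; apply: eq_bigr => n _; rewrite sum_coeff ?cube_uniq.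
have c_lt n : (n < n0)%N -> c n = evalf P h * evalf u h ^+ n.
  move=> nn; rewrite -evalfX -evalfM -/(geom n) /c big_mkcond big_seq [RHS]big_seq.
  apply: eq_bigr => m mg; have nN : (D * n.+1 <= N)%N by rewrite mulnC -leq_divRL.
  have /and3P[h1 h2 h3] := geom_small mg.
  by rewrite mem_cube !(leq_trans _ nN).
have c_le n : `|c n| <= evala P h * 2^-1 ^+ n.
  apply: le_trans (evala_geom n); rewrite /c /evala big_mkcond.
  apply: (le_trans (ler_norm_sum _ _ _)); apply: ler_sum => m _.
  by case: ifP => //; rewrite normr0.
rewrite (@big_cat_nat _ _ _ n0)//= addrAC (le_trans (ler_normD _ _))//.
rewrite [X in _ <= X](_ : _ = 2 * evala P h * 2^-1 ^+ n0
  + evala P h * (2 * 2^-1 ^+ n0)); last by ring.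
apply: lerD; last first.
  apply: (le_trans (ler_norm_sum _ _ _)); apply: (le_trans (ler_sum _ (fun n _ => c_le n))).
  rewrite -mulr_sumr ler_wpM2l ?evala_ge0//.
  by have := sum_half n0 (M - n0); rewrite subnKC.
under eq_big_nat => n /andP[_ nn] do rewrite (c_lt n nn).
rewrite -mulr_sumr big_mkord geom_sum ?evalf_neq1//.
have u1 : 1 - evalf u h != 0 by rewrite subr_eq0 eq_sym evalf_neq1.
rewrite [X in `|X|](_ : _ = - (evalf P h * evalf u h ^+ n0 / (1 - evalf u h))); last by field.
rewrite normrN !normrM normfV normrX.
have uh := le_trans (evalf_le u h) u_half.
have d : 2^-1 <= `|1 - evalf u h|.
  apply: le_trans (ler_norm _); move: uh; rewrite ler_norml => /andP[_ ?]; lra.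
have dV : `|1 - evalf u h|^-1 <= 2 by rewrite -[leRHS]invrK lef_pV2// posrE; lra.
rewrite -mulrA (mulrC 2) -mulrA ler_pM ?evalf_le ?mulr_ge0 ?invr_ge0 ?exprn_ge0//.
by rewrite mulrC ler_pM ?invr_ge0 ?exprn_ge0// lerXn2r// nnegrE.
Qed.

End Geometric.
End FormalSums.

(** * Analyticity of rational functions *)

Section Analytic.
Variable R : realType.
Local Notation expo := (nat * nat * nat)%type.
Implicit Types (f : R * R * R -> R) (p q h : R * R * R).

Lemma polyfun_evalf f p : polyfun f -> exists l, forall q, f q = evalf l (q - p).
Proof.
elim=> {f} [c||||f g _ [l lE] _ [l' lE']|f g _ [l lE] _ [l' lE']].
- exists [:: (c, (0, 0, 0)%N)] => q; by rewrite /evalf big_seq1 hpow0 mulr1.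
- exists [:: (p.1.1, (0, 0, 0)%N); (1, (1, 0, 0)%N)] => q.
  by rewrite /evalf big_cons big_seq1 hpow0 /hpow /= !expr0 expr1 !mulr1 mul1r subrKC.
- exists [:: (p.1.2, (0, 0, 0)%N); (1, (0, 1, 0)%N)] => q.
  by rewrite /evalf big_cons big_seq1 hpow0 /hpow /= !expr0 expr1 !mulr1 !mul1r subrKC.
- exists [:: (p.2, (0, 0, 0)%N); (1, (0, 0, 1)%N)] => q.
  by rewrite /evalf big_cons big_seq1 hpow0 /hpow /= !expr0 expr1 !mulr1 !mul1r subrKC.
- by exists (l ++ l') => q; rewrite /evalf big_cat /= lE lE'.
- by exists (mulf l l') => q; rewrite evalfM lE lE'.
Qed.

Lemma evalf_0 l : evalf l (0 : R * R * R) = \sum_(m <- l | deg m.2 == 0) m.1.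
Proof.
rewrite /evalf [RHS]big_mkcond; apply: eq_bigr => -[c [[i j] k]] _.
rewrite /hpow /deg /= !expr0n.
by case: i; case: j; case: k => *; rewrite /= ?mulr0 ?mul0r ?mulr0 ?mulr1.
Qed.

Definition scalef (c : R) l : seq (R * expo) := [seq (c * m.1, m.2) | m <- l].

Lemma evalf_scale c l h : evalf (scalef c l) h = c * evalf l h.
Proof.
by rewrite /evalf big_map mulr_sumr; apply: eq_bigr => m _ /=; rewrite mulrA.
Qed.

Lemma small_expo_bound (l : seq (R * expo)) : exists D, forall m, m \in l -> small_expo D m.2.
Proof.
exists (\max_(m <- l) deg m.2).+1 => -[c [[i j] k]] ml.
have : (deg (i, j, k) <= \max_(m <- l) deg m.2)%N.
  exact: (leq_bigmax_seq (F := fun m : R * expo => deg m.2) _ ml).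
by rewrite /small_expo /deg /=; lia.
Qed.

Lemma evala_near0 (u : seq (R * expo)) p : (forall m, m \in u -> (0 < deg m.2)%N) ->
  \forall q \near p, evala u (q - p) <= 2^-1.
Proof.
move=> u0.
(* Every monomial of [u] has positive degree, so coordinates of size at most e <= 1 bound it by e
   times its coefficient. The summand 1 keeps the denominator positive when [u] is empty. *)
pose e : R := (2 * (1 + \sum_(m <- u) `|m.1|))^-1.
have S0 : 0 <= \sum_(m <- u) `|m.1| by exact: sumr_ge0.
have e0 : 0 < e by rewrite invr_gt0; lra.
have e1 : e <= 1 by rewrite invf_le1; lra.
have small (a : R * R * R -> R) : {for p, continuous a} -> \forall q \near p, `|a q - a p| <= e.
  by move=> /cvgrPdist_le /(_ e e0); apply: filterS => q; rewrite distrC.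
have s1 := small _ (@continuous_polyfun _ _ (polyfun_x R) p).
have s2 := small _ (@continuous_polyfun _ _ (polyfun_y R) p).
have s3 := small _ (@continuous_polyfun _ _ (polyfun_t R) p).
near=> q.
have q1 : `|(q - p).1.1| <= e by near: q.
have q2 : `|(q - p).1.2| <= e by near: q.
have q3 : `|(q - p).2| <= e by near: q.
have le m : m \in u -> `|m.1 * hpow (q - p) m.2| <= `|m.1| * e.
  move=> mu; rewrite normrM ler_wpM2l// /hpow !normrM !normrX.
  have eX x n : `|x : R| <= e -> `|x| ^+ n <= e ^+ n.
    by move=> xe; rewrite lerXn2r// nnegrE ltW.
  apply: (@le_trans _ _ (e ^+ deg m.2)).
    by rewrite /deg !exprD !ler_pM ?mulr_ge0 ?exprn_ge0// eX.
  by rewrite -[leRHS]expr1 ler_wiXn2l ?u0// ltW.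
rewrite /evala big_seq (le_trans (ler_sum _ le))// -big_seq -mulr_suml.
by rewrite /e ler_pdivrMr; lra.
Unshelve. all: by end_near. Qed.

Lemma ratfun_analytic A f p : ratfun A f -> open A -> A p -> analytic_at f p.
Proof.
move=> [P [Q [pP pQ fE]]] oA Ap.
have [lP PE] := polyfun_evalf p pP; have [lQ QE] := polyfun_evalf p pQ.
pose q0 := Q p; have q00 : q0 != 0 by have [] := fE p Ap.
(* Dividing by the constant term gives Q = q0 (1 - u), where [u] collects the terms of positive
   degree. *)
pose u := scalef (- q0^-1) [seq m <- lQ | deg m.2 != 0].
pose P' := scalef q0^-1 lP.
have u0 m : m \in u -> (0 < deg m.2)%N.
  by move=> /mapP[m']; rewrite mem_filter lt0n => /andP[h _] ->.
have q0E : q0 = \sum_(m <- lQ | deg m.2 == 0) m.1 by rewrite /q0 QE subrr evalf_0.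
have QuE q : Q q = q0 * (1 - evalf u (q - p)).
  rewrite /u evalf_scale mulNr opprK mulrDr mulr1 mulVKf// QE.
  rewrite {1}/evalf (bigID (fun m => deg m.2 == 0)) /= /evalf big_filter; congr (_ + _).
  rewrite q0E; apply: eq_bigr => -[c [[i j] k]] /=.
  by rewrite /deg /= !addn_eq0 => /andP[/andP[/eqP-> /eqP->] /eqP->]; rewrite hpow0 mulr1.
have [D1 DP] := small_expo_bound P'; have [D2 Du] := small_expo_bound u.
pose D := (D1 + D2).+1.
have DP' m : m \in P' -> small_expo D m.2.
  by move=> /DP; rewrite /small_expo /D; lia.
have Du' m : m \in u -> small_expo D m.2.
  by move=> /Du; rewrite /small_expo /D; lia.
exists (fun i j k => quot_coeff P' u (i, j, k)).
have nA : \forall q \near p, A q by exact: open_nbhs_nbhs.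
have nu := evala_near0 p u0.
near=> q.
have Aq : A q by near: q.
have uq : evala u (q - p) <= 2^-1 by near: q.
have tE x : power_term (fun i j k => quot_coeff P' u (i, j, k)) (q - p) x.1.1 x.1.2 x.2
    = quot_coeff P' u x * hpow (q - p) x.
  by case: x => [[i j] k]; rewrite /power_term /hpow /= !mulrA.
split.
  rewrite /summable; apply: (@le_lt_trans _ _ (2 * evala P' (q - p))%:E); last exact: ltry.
  apply: ge_ereal_sup => _ [X [finX _] <-].
  rewrite fsbig_finite//=.
  under eq_bigr do rewrite tE /=.
  rewrite sumEFin lee_fin.
  exact (@sum_abs_quot_coeff _ _ _ u0 _ uq _ (finmap.fset_uniq _)).
have -> : (fun n : nat => \sum_(i < n) \sum_(j < n) \sum_(k < n)
    power_term (fun i j k => quot_coeff P' u (i, j, k)) (q - p) i j k) =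
   (fun n => \sum_(x <- cube n) quot_coeff P' u x * hpow (q - p) x).
  apply/funext => n; rewrite sum_cube; apply: eq_bigr => i _; apply: eq_bigr => j _.
  by apply: eq_bigr => k _; rewrite -tE.
have -> : f q = evalf P' (q - p) / (1 - evalf u (q - p)).
  by rewrite (fE q Aq).2 QuE PE [evalf P' _]evalf_scale invfM mulrA (mulrC q0^-1).
apply/cvgrPdist_le => e e0.
have [n1 _ n1P] : \forall n \near \oo, 4 * evala P' (q - p) * 2^-1 ^+ n <= e.
  have c : (4 * evala P' (q - p)) * (2^-1 : R) ^+ n @[n --> \oo] --> (0 : R).
    rewrite -[X in _ --> X](mulr0 (4 * evala P' (q - p))).
    by apply: cvgMr; apply: cvg_expr; rewrite ger0_norm; lra.
  move/cvgrPdist_le : c => /(_ e e0); apply: filterS => n; rewrite sub0r normrN.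
  exact: le_trans (ler_norm _).
(* The error decays in N / D, so the rank [n1] is multiplied by [D]. *)
exists (D * n1)%N => // N /= hN; rewrite distrC.
apply: le_trans (quot_cube_close u0 DP' Du' uq (ltn0Sn _) N) _.
by apply: n1P; rewrite /= leq_divRL// mulnC.
Unshelve. all: by end_near. Qed.

End Analytic.

(** * The integral of the squared solution *)

Section Rectangle.
Variable R : realType.
Local Notation mu := (@lebesgue_measure R).
Local Notation mu2 := ((@lebesgue_measure R) \x (@lebesgue_measure R))%E.
Local Notation TR := (measurableTypeR R).
Implicit Types (g : TR * TR -> R) (a b c d : R).

Definition rect a b c d : set (TR * TR) := `[a, b] `*` `[c, d].

Lemma measurable_rect a b c d : measurable (rect a b c d).
Proof. by apply: measurableX; exact: measurable_itv. Qed.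

Lemma rect_integrable g a b c d : measurable_fun setT g ->
  [bounded g q | q in rect a b c d] -> mu2.-integrable (rect a b c d) (EFin \o g).
Proof.
move=> mg bg; apply: measurable_bounded_integrable => //.
- exact: measurable_rect.
- rewrite [X in (X < _)%E](_ : _ = (mu `[a, b]%classic * mu `[c, d]%classic)%E); last first.
    by apply: product_measure1E; exact: measurable_itv.
  rewrite !lebesgue_measure_itv /=.
  by case: ifP => _; case: ifP => _; rewrite ?mule0 ?mul0e ?ltry.
- exact: measurable_funS mg.
Qed.

Lemma integral_rect21 g a b c d (G : R -> R) : measurable_fun setT g ->
  [bounded g q | q in rect a b c d] ->
  (forall y, c <= y <= d -> (\int[mu]_(x in `[a, b]) (g (x, y))%:E = (G y)%:E)%E) ->
  (\int[mu2]_(q in rect a b c d) (g q)%:E = \int[mu]_(y in `[c, d]) (G y)%:E)%E.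
Proof.
move=> mg bg gG; have ig := rect_integrable mg bg.
rewrite integral_mkcond -integral21_prod_meas1; last first.
  exact ((integrable_mkcond _ (measurable_rect a b c d)).1 ig).
rewrite [RHS]integral_mkcond; apply: eq_integral => y _; rewrite /fubini_G patchE.
case: ifPn => [|yN].
  rewrite inE /= in_itv /= => ycd; rewrite -(gG _ ycd) [RHS]integral_mkcond.
  apply: eq_integral => x _; rewrite !patchE /rect.
  by rewrite in_setX /= !mem_setE !in_itv /= ycd andbT.
rewrite integral0_eq// => x _; rewrite patchE /rect in_setX /=.
by rewrite (negbTE yN) andbF.
Qed.

Lemma integral_rect12 g a b c d (G : R -> R) : measurable_fun setT g ->
  [bounded g q | q in rect a b c d] ->
  (forall x, a <= x <= b -> (\int[mu]_(y in `[c, d]) (g (x, y))%:E = (G x)%:E)%E) ->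
  (\int[mu2]_(q in rect a b c d) (g q)%:E = \int[mu]_(x in `[a, b]) (G x)%:E)%E.
Proof.
move=> mg bg gG; have ig := rect_integrable mg bg.
rewrite integral_mkcond -integral12_prod_meas1; last first.
  exact ((integrable_mkcond _ (measurable_rect a b c d)).1 ig).
rewrite [RHS]integral_mkcond; apply: eq_integral => x _; rewrite /fubini_F patchE.
case: ifPn => [|xN].
  rewrite inE /= in_itv /= => xab; rewrite -(gG _ xab) [RHS]integral_mkcond.
  apply: eq_integral => y _; rewrite !patchE /rect.
  by rewrite in_setX /= !mem_setE !in_itv /= xab.
rewrite integral0_eq// => y _; rewrite patchE /rect in_setX /=.
by rewrite (negbTE xN).
Qed.

End Rectangle.

Section OneVariable.
Variable R : realType.
Local Notation mu := (@lebesgue_measure R).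
Implicit Types (F f g : R -> R) (x a b d e : R).

Lemma is_derive1D f g x d e : is_derive x 1 f d -> is_derive x 1 g e ->
  is_derive x 1 (fun z => f z + g z) (d + e).
Proof. by move=> df dg; exact: is_deriveD. Qed.

Lemma is_derive1N f x d : is_derive x 1 f d -> is_derive x 1 (fun z => - f z) (- d).
Proof. by move=> df; exact: is_deriveN. Qed.

Lemma is_derive1M f g x d e : is_derive x 1 f d -> is_derive x 1 g e ->
  is_derive x 1 (fun z => f z * g z) (f x * e + g x * d).
Proof. by move=> df dg; exact: is_deriveM. Qed.

Lemma is_derive1V f x d : f x != 0 -> is_derive x 1 f d ->
  is_derive x 1 (fun z => (f z)^-1) (- d / f x ^+ 2).
Proof.
move=> f0 df; split; first exact: derivableV.
by rewrite deriveV// derive_val /GRing.scale /= mulrC mulrN mulNr.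
Qed.

Lemma integral_FTC F f a b : a < b ->
  (forall x, a <= x <= b -> is_derive x 1 F (f x)) ->
  (forall x, a <= x <= b -> {for x, continuous f}) ->
  (\int[mu]_(x in `[a, b]) (f x)%:E = (F b - F a)%:E)%E.
Proof.
move=> ab dF cf; rewrite EFinB; apply: continuous_FTC2 => //.
- by apply: continuous_in_subspaceT => x; rewrite inE /= in_itv /=; exact: cf.
- have cF x : a <= x <= b -> {for x, continuous F}.
    by move=> /dF dFx; apply: differentiable_continuous; apply/derivable1_diffP.
  split.
  + by move=> x; rewrite in_itv /= => /andP[ax xb]; have := dF x; rewrite !ltW// => /(_ isT)[].
  + by apply: cvg_at_right_filter; apply: cF; rewrite lexx ltW.
  + by apply: cvg_at_left_filter; apply: cF; rewrite lexx ltW.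
- move=> x; rewrite in_itv /= => /andP[ax xb]; rewrite derive1E.
  by have [] := dF x; rewrite ?ltW.
Qed.

Lemma continuous_integrable f a b : (forall x, a <= x <= b -> {for x, continuous f}) ->
  mu.-integrable `[a, b] (EFin \o f).
Proof.
move=> cf; apply: continuous_compact_integrable; first exact: segment_compact.
by apply: continuous_in_subspaceT => x; rewrite inE /= in_itv /=; exact: cf.
Qed.

(** The integral of f lies between those of g - e and g + e, which have explicit primitives. This
    replaces a boundary integrand by an arctangent kernel. *)
Lemma integral_close f F g a b e : a < b -> 0 <= e ->
  (forall x, a <= x <= b -> {for x, continuous f}) ->
  (forall x, a <= x <= b -> is_derive x 1 F (g x)) ->
  (forall x, a <= x <= b -> {for x, continuous g}) ->
  (forall x, a <= x <= b -> `|f x - g x| <= e) ->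
  exists2 I, (\int[mu]_(x in `[a, b]) (f x)%:E = I%:E)%E
    & `|I - (F b - F a)| <= e * (b - a).
Proof.
move=> ab e0 cf dF cg fg.
have intf := continuous_integrable cf.
have FTC s : (\int[mu]_(x in `[a, b]) (g x + s)%:E = (F b - F a + s * (b - a))%:E)%E.
  have d x : a <= x <= b -> is_derive x 1 (fun x => F x + s * x) (g x + s).
    move=> xab; apply: is_derive_eq (is_derive1D (dF x xab)
      (is_derive1M (is_derive_cst s x 1) (is_derive_id x 1))) _.
    by rewrite mulr1 mulr0 addr0.
  have c x : a <= x <= b -> {for x, continuous (fun x => g x + s)}.
    by move=> xab; apply: continuousD; [exact: cg|exact: cst_continuous].
  by rewrite (integral_FTC ab d c); congr (_%:E); ring.
have intg s : mu.-integrable `[a, b] (EFin \o (fun x => g x + s)).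
  by apply: continuous_integrable => x xab; apply: continuousD; [exact: cg|exact: cst_continuous].
exists (fine (\int[mu]_(x in `[a, b]) (f x)%:E)%E).
  by rewrite fineK//; exact: integrable_fin_num.
rewrite ler_norml; apply/andP; split.
- rewrite lerBrDr -lee_fin fineK ?integrable_fin_num//.
  have -> : (- (e * (b - a)) + (F b - F a))%:E = (\int[mu]_(x in `[a, b]) (g x + (- e))%:E)%E.
    by rewrite FTC; congr (_%:E); ring.
  apply: le_integral => //; first exact: intg.
  move=> x; rewrite inE /= in_itv /= => /fg.
  by rewrite lee_fin ler_norml => /andP[? _]; lra.
- rewrite lerBlDr -lee_fin fineK ?integrable_fin_num//.
  have -> : (e * (b - a) + (F b - F a))%:E = (\int[mu]_(x in `[a, b]) (g x + e)%:E)%E.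
    by rewrite FTC; congr (_%:E); ring.
  apply: le_integral => //; first exact: intg.
  move=> x; rewrite inE /= in_itv /= => /fg.
  by rewrite lee_fin ler_norml => /andP[_ ?]; lra.
Qed.

End OneVariable.

Section Slices.
Variable R : realType.
Local Notation TR := (measurableTypeR R).
Implicit Types (f : R * R * R -> R) (x y t : R).

(** Inversion is continuous off 0, and the point 0, where it takes the value 0, is split off. *)
Lemma measurable_invr : measurable_fun setT (@GRing.inv R).
Proof.
have -> : [set: R] = [set x | x != 0] `|` [set 0].
  by apply/seteqP; split => x //= _; case: (eqVneq x 0) => [->|h]; [right|left].
have o : open [set x : R | x != 0].
  exact: open_neq.
apply/measurable_funU => //; first exact: open_measurable.
split; last exact: measurable_fun_set1.
by apply: open_continuous_measurable_fun => // x; rewrite inE /=; exact: inv_continuous.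
Qed.

Lemma measurable_slice f t : polyfun f ->
  measurable_fun setT (fun q : TR * TR => f (q.1, q.2, t)).
Proof.
elim=> {f} [c||||f g _ mf _ mg|f g _ mf _ mg] /=.
- exact: measurable_cst.
- exact: measurable_fst.
- exact: measurable_snd.
- exact: measurable_cst.
- exact: measurable_funD.
- exact: measurable_funM.
Qed.

Lemma continuous_slice f (A : set (R * R * R)) t (q : TR * TR) : open A -> ratfun A f ->
  A (q.1, q.2, t) -> {for q, continuous (fun q : R * R => f (q.1, q.2, t))}.
Proof.
move=> oA rf Aq; have c := ratfun_continuous oA rf Aq.
have c' : (r.1, r.2, t) @[r --> (q : R * R)] --> ((q.1, q.2, t) : R * R * R).
  exact: (cvg_pair (cvg_pair cvg_fst cvg_snd) (cvg_cst t)).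
exact: (cvg_comp _ _ c' c).
Qed.

Lemma continuous_slice_x f (A : set (R * R * R)) x y t : open A -> ratfun A f ->
  A (x, y, t) -> {for x, continuous (fun x => f (x, y, t))}.
Proof.
move=> oA rf Aq; have c := ratfun_continuous oA rf Aq.
have c' : (r, y, t) @[r --> x] --> ((x, y, t) : R * R * R).
  exact: (cvg_pair (cvg_pair cvg_id (cvg_cst y)) (cvg_cst t)).
exact: (cvg_comp _ _ c' c).
Qed.

Lemma continuous_slice_y f (A : set (R * R * R)) x y t : open A -> ratfun A f ->
  A (x, y, t) -> {for y, continuous (fun y => f (x, y, t))}.
Proof.
move=> oA rf Aq; have c := ratfun_continuous oA rf Aq.
have c' : (x, r, t) @[r --> y] --> ((x, y, t) : R * R * R).
  exact: (cvg_pair (cvg_pair (cvg_cst x) cvg_id) (cvg_cst t)).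
exact: (cvg_comp _ _ c' c).
Qed.

Lemma bounded_slice f (A : set (R * R * R)) a b c d t : open A -> ratfun A f ->
  (forall q : TR * TR, rect a b c d q -> A (q.1, q.2, t)) ->
  [bounded f (q.1, q.2, t) | q in rect a b c d].
Proof.
move=> oA rf hA.
have cpt : compact (rect a b c d : set (R * R)).
  by apply: compact_setX; exact: segment_compact.
have cf : {within (rect a b c d : set (R * R)), continuous (fun q : R * R => f (q.1, q.2, t))}.
  by apply: continuous_in_subspaceT => q; rewrite inE => /hA; exact: continuous_slice.
have /compact_bounded[M [Mr hM]] := continuous_compact cf cpt.
by exists M; split => // N MN q /= hq; apply: (hM N MN); exists q.
Qed.

End Slices.

(** * The gradient of log Q and its flux through a rectangle *)

Section Flux.
Variable R : realType.
Local Notation TR := (measurableTypeR R).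
Implicit Types x y s : R.

Definition rden_x x y s := 2 * x + 4 / 3 * (x * (x ^+ 2 + y ^+ 2))
  + 2 / 3 * (x * (x ^+ 2 + y ^+ 2) ^+ 2) + 8 / 3 * (x * y ^+ 2)
  - 2 * s * (1 - x ^+ 2 + y ^+ 2).
Definition rden_y x y s := 2 * y + 4 / 3 * (y * (x ^+ 2 + y ^+ 2))
  + 2 / 3 * (y * (x ^+ 2 + y ^+ 2) ^+ 2) + 8 / 3 * (x ^+ 2 * y) - 4 * s * (x * y).
Definition rden_xx x y s := 2 + 4 / 3 * (3 * x ^+ 2 + y ^+ 2)
  + 2 / 3 * ((x ^+ 2 + y ^+ 2) ^+ 2 + 4 * (x ^+ 2 * (x ^+ 2 + y ^+ 2)))
  + 8 / 3 * y ^+ 2 + 4 * s * x.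
Definition rden_yy x y s := 2 + 4 / 3 * (x ^+ 2 + 3 * y ^+ 2)
  + 2 / 3 * ((x ^+ 2 + y ^+ 2) ^+ 2 + 4 * (y ^+ 2 * (x ^+ 2 + y ^+ 2)))
  + 8 / 3 * x ^+ 2 - 4 * s * x.

(** Derivatives of log Q as rational functions; the logarithm itself never occurs. *)
Definition log_x x y s := rden_x x y s / rden x y s.
Definition log_y x y s := rden_y x y s / rden x y s.
Definition log_xx x y s := rden_xx x y s / rden x y s - log_x x y s ^+ 2.
Definition log_yy x y s := rden_yy x y s / rden x y s - log_y x y s ^+ 2.

Lemma laplacian_log x y s : rden x y s != 0 ->
  (rnum x y s / rden x y s) ^+ 2 = 4^-1 * (log_xx x y s + log_yy x y s).
Proof.
move=> d0; rewrite /log_xx /log_yy /log_x /log_y.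
have key : 4 * rnum x y s ^+ 2 = (rden_xx x y s + rden_yy x y s) * rden x y s
    - rden_x x y s ^+ 2 - rden_y x y s ^+ 2.
  by rewrite /rnum /rden /rden_x /rden_y /rden_xx /rden_yy; field.
transitivity (4^-1 * (4 * rnum x y s ^+ 2) / rden x y s ^+ 2); first by field.
by rewrite key; field.
Qed.

Lemma is_derive_rden_x x y s : is_derive x 1 (fun x => rden x y s) (rden_x x y s).
Proof.
rewrite /rden /rden_x; apply: is_derive_eq.
by rewrite /GRing.scale /=; field.
Qed.

Lemma is_derive_rden_y x y s : is_derive y 1 (fun y => rden x y s) (rden_y x y s).
Proof.
rewrite /rden /rden_y; apply: is_derive_eq.
by rewrite /GRing.scale /=; field.
Qed.

Lemma is_derive_rden_xx x y s : is_derive x 1 (fun x => rden_x x y s) (rden_xx x y s).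
Proof.
rewrite /rden_xx /rden_x; apply: is_derive_eq.
by rewrite /GRing.scale /=; field.
Qed.

Lemma is_derive_rden_yy x y s : is_derive y 1 (fun y => rden_y x y s) (rden_yy x y s).
Proof.
rewrite /rden_yy /rden_y; apply: is_derive_eq.
by rewrite /GRing.scale /=; field.
Qed.

Lemma is_derive_log_x x y s : rden x y s != 0 ->
  is_derive x 1 (fun x => log_x x y s) (log_xx x y s).
Proof.
move=> d0; have h := is_derive1M (is_derive_rden_xx x y s)
  (@is_derive1V _ (fun x => rden x y s) x _ d0 (is_derive_rden_x x y s)).
apply: is_derive_eq h _.
by rewrite /log_xx /log_x; field.
Qed.

Lemma is_derive_log_y x y s : rden x y s != 0 ->
  is_derive y 1 (fun y => log_y x y s) (log_yy x y s).
Proof.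
move=> d0; have h := is_derive1M (is_derive_rden_yy x y s)
  (@is_derive1V _ (fun y => rden x y s) y _ d0 (is_derive_rden_y x y s)).
apply: is_derive_eq h _.
by rewrite /log_yy /log_y; field.
Qed.

Section Ratfuns.
Variable C : R.
Let A : set (R * R * R) := [set p | p != sing C].
Local Notation app F := (fun p : R * R * R => F p.1.1 p.1.2 (C - p.2)).

Lemma polyfun_rden_x : polyfun (app rden_x).
Proof. by rewrite /rden_x; polyfun_auto. Qed.
Lemma polyfun_rden_y : polyfun (app rden_y).
Proof. by rewrite /rden_y; polyfun_auto. Qed.
Lemma polyfun_rden_xx : polyfun (app rden_xx).
Proof. by rewrite /rden_xx; polyfun_auto. Qed.
Lemma polyfun_rden_yy : polyfun (app rden_yy).
Proof. by rewrite /rden_yy; polyfun_auto. Qed.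

Lemma ratfun_log_x : ratfun A (app log_x).
Proof. exact: ratfunM (polyfun_ratfun A polyfun_rden_x) (@ratfun_rdenV R C). Qed.
Lemma ratfun_log_y : ratfun A (app log_y).
Proof. exact: ratfunM (polyfun_ratfun A polyfun_rden_y) (@ratfun_rdenV R C). Qed.
Lemma ratfun_log_xx : ratfun A (app log_xx).
Proof.
apply: (ratfunD (ratfunM (polyfun_ratfun A polyfun_rden_xx) (@ratfun_rdenV R C))).
apply: ratfunN; exact: ratfunM ratfun_log_x ratfun_log_x.
Qed.
Lemma ratfun_log_yy : ratfun A (app log_yy).
Proof.
apply: (ratfunD (ratfunM (polyfun_ratfun A polyfun_rden_yy) (@ratfun_rdenV R C))).
apply: ratfunN; exact: ratfunM ratfun_log_y ratfun_log_y.
Qed.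

End Ratfuns.

Lemma measurable_quot (F G : R * R * R -> R) t : polyfun F -> polyfun G ->
  measurable_fun setT (fun q : TR * TR => F (q.1, q.2, t) / G (q.1, q.2, t)).
Proof.
move=> pF pG; apply: measurable_funM; first exact: measurable_slice.
by apply: (measurableT_comp (@measurable_invr R)); exact: measurable_slice.
Qed.

Lemma measurable_log_xx s : measurable_fun setT (fun q : TR * TR => log_xx q.1 q.2 s).
Proof.
apply: measurable_funB.
  have := measurable_quot 0 (polyfun_rden_xx s) (polyfun_rden s); rewrite /= subr0; exact.
apply: measurable_funX.
have := measurable_quot 0 (polyfun_rden_x s) (polyfun_rden s); rewrite /= subr0; exact.
Qed.

Lemma measurable_log_yy s : measurable_fun setT (fun q : TR * TR => log_yy q.1 q.2 s).
Proof.
apply: measurable_funB.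
  have := measurable_quot 0 (polyfun_rden_yy s) (polyfun_rden s); rewrite /= subr0; exact.
apply: measurable_funX.
have := measurable_quot 0 (polyfun_rden_y s) (polyfun_rden s); rewrite /= subr0; exact.
Qed.

Lemma measurable_Usqr s :
  measurable_fun setT (fun q : TR * TR => (rnum q.1 q.2 s / rden q.1 q.2 s) ^+ 2).
Proof.
apply: measurable_funX.
have := measurable_quot 0 (polyfun_rnum s) (polyfun_rden s); rewrite /= subr0; exact.
Qed.

End Flux.

Section FluxFormula.
Variable R : realType.
Local Notation TR := (measurableTypeR R).
Local Notation mu := (@lebesgue_measure R).
Local Notation mu2 := ((@lebesgue_measure R) \x (@lebesgue_measure R))%E.
Variables (s a b c d : R).
Hypotheses (ab : a < b) (cd : c < d).
Hypothesis d0 : forall x y, a <= x <= b -> c <= y <= d -> rden x y s != 0.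

(* The space-time functions are used with [C = s] on the slice [t = 0]. *)
Let A : set (R * R * R) := [set p | p != sing s].
Let oA : open A := @open_neq_sing R s.

Let inA x y : a <= x <= b -> c <= y <= d -> A (x, y, 0).
Proof.
move=> hx hy; apply: contraTneq (d0 hx hy) => -[-> -> <-].
by rewrite negbK rden_eq0 !eqxx.
Qed.

Let cont_y (F : R -> R -> R -> R) x y :
  ratfun A (fun p => F p.1.1 p.1.2 (s - p.2)) -> a <= x <= b -> c <= y <= d ->
  {for y, continuous (fun y => F x y s)}.
Proof.
by move=> rF hx hy; have := continuous_slice_y oA rF (inA hx hy); rewrite /= subr0.
Qed.

Let cont_x (F : R -> R -> R -> R) x y :
  ratfun A (fun p => F p.1.1 p.1.2 (s - p.2)) -> a <= x <= b -> c <= y <= d ->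
  {for x, continuous (fun x => F x y s)}.
Proof.
by move=> rF hx hy; have := continuous_slice_x oA rF (inA hx hy); rewrite /= subr0.
Qed.

Let bnd (F : R -> R -> R -> R) :
  ratfun A (fun p => F p.1.1 p.1.2 (s - p.2)) -> [bounded F q.1 q.2 s | q in rect a b c d].
Proof.
move=> rF; have := @bounded_slice _ _ A a b c d 0 oA rF; rewrite /= subr0; apply.
by move=> [x y] [/=]; rewrite !in_itv /=; exact: inA.
Qed.

(** The x-derivative part of the Laplacian is integrated first in x and the y-derivative part first
    in y, so each inner integral is a difference of boundary values. *)
Lemma flux_formula :
  (\int[mu2]_(q in rect a b c d) ((rnum q.1 q.2 s / rden q.1 q.2 s) ^+ 2)%:E
  = (4^-1)%:E * (\int[mu]_(y in `[c, d]) (log_x b y s - log_x a y s)%:E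
               + \int[mu]_(x in `[a, b]) (log_y x d s - log_y x c s)%:E))%E.
Proof.
have bxx := bnd (ratfun_log_xx s); have byy := bnd (ratfun_log_yy s).
have mxx := measurable_log_xx s; have myy := measurable_log_yy s.
have ixx := rect_integrable mxx bxx; have iyy := rect_integrable myy byy.
transitivity (\int[mu2]_(q in rect a b c d)
    ((4^-1)%:E * ((log_xx q.1 q.2 s)%:E + (log_yy q.1 q.2 s)%:E)))%E.
  apply: eq_integral => -[x y]; rewrite inE => -[/=]; rewrite !in_itv /= => hx hy.
  by rewrite laplacian_log ?d0// EFinM EFinD.
have mr := measurable_rect a b c d.
rewrite integralZl//; last exact: integrableD.
rewrite integralD//; congr (_ * (_ + _))%E.
- apply: (integral_rect21 mxx bxx) => y hy.
  have dx x : a <= x <= b -> is_derive x 1 (fun x => log_x x y s) (log_xx x y s).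
    by move=> hx; apply: is_derive_log_x; exact: d0.
  have cx x : a <= x <= b -> {for x, continuous (fun x => log_xx x y s)}.
    by move=> hx; apply: cont_x => //; exact: ratfun_log_xx.
  exact (integral_FTC ab dx cx).
- apply: (integral_rect12 myy byy) => x hx.
  have dy y : c <= y <= d -> is_derive y 1 (fun y => log_y x y s) (log_yy x y s).
    by move=> hy; apply: is_derive_log_y; exact: d0.
  have cy y : c <= y <= d -> {for y, continuous (fun y => log_yy x y s)}.
    by move=> hy; apply: cont_y => //; exact: ratfun_log_yy.
  exact (integral_FTC cd dy cy).
Qed.

(** [g1] models the flux through the two vertical sides together, [g2] that through the two
    horizontal ones. *)
Lemma flux_close (G1 g1 G2 g2 : R -> R) e1 e2 : 0 <= e1 -> 0 <= e2 ->
  (forall y, c <= y <= d -> is_derive y 1 G1 (g1 y)) ->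
  (forall y, c <= y <= d -> {for y, continuous g1}) ->
  (forall y, c <= y <= d -> `|log_x b y s - log_x a y s - g1 y| <= e1) ->
  (forall x, a <= x <= b -> is_derive x 1 G2 (g2 x)) ->
  (forall x, a <= x <= b -> {for x, continuous g2}) ->
  (forall x, a <= x <= b -> `|log_y x d s - log_y x c s - g2 x| <= e2) ->
  exists2 I, (\int[mu2]_(q in rect a b c d)
      ((rnum q.1 q.2 s / rden q.1 q.2 s) ^+ 2)%:E = I%:E)%E &
    `|4 * I - ((G1 d - G1 c) + (G2 b - G2 a))| <= e1 * (d - c) + e2 * (b - a).
Proof.
move=> e10 e20 dG1 cg1 h1 dG2 cg2 h2.
have aab : a <= a <= b by rewrite lexx ltW.
have bab : a <= b <= b by rewrite lexx ltW.
have ccd : c <= c <= d by rewrite lexx ltW.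
have dcd : c <= d <= d by rewrite lexx ltW.
have c1 y : c <= y <= d -> {for y, continuous (fun y => log_x b y s - log_x a y s)}.
  by move=> hy; apply: continuousB; apply: cont_y => //; exact: ratfun_log_x.
have c2 x : a <= x <= b -> {for x, continuous (fun x => log_y x d s - log_y x c s)}.
  by move=> hx; apply: continuousB; apply: cont_x => //; exact: ratfun_log_y.
have [I1 E1 H1] := integral_close cd e10 c1 dG1 cg1 h1.
have [I2 E2 H2] := integral_close ab e20 c2 dG2 cg2 h2.
exists (4^-1 * (I1 + I2)); first by rewrite flux_formula E1 E2.
rewrite [X in `|X|](_ : _ = (I1 - (G1 d - G1 c)) + (I2 - (G2 b - G2 a))); last by field.
by rewrite (le_trans (ler_normD _ _))// lerD.
Qed.

End FluxFormula.

(** * Asymptotics of the gradient of log Q *)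

Section Estimates.
Variable R : realType.
Implicit Types x y s r : R.

Lemma monomial_bound x y s r (i j k : nat) : `|x| <= r -> `|y| <= r -> `|s| <= r ->
  - r ^+ (i + j + k) <= x ^+ i * y ^+ j * s ^+ k <= r ^+ (i + j + k).
Proof.
move=> xr yr sr; rewrite -ler_norml !normrM !normrX !exprD.
have r0 : 0 <= r := le_trans (normr_ge0 x) xr.
by rewrite !ler_pM ?mulr_ge0 ?exprn_ge0// lerXn2r// nnegrE.
Qed.

Section Far.
Variables (x y s r : R).
Hypotheses (rs : 1 + 72 * `|s| <= r) (e : x ^+ 2 + y ^+ 2 = r ^+ 2).

Let s0 : 0 <= `|s|. Proof. exact: normr_ge0. Qed.
Let r1 : 1 <= r. Proof. by move: rs s0 => *; lra. Qed.
Let r0 : 0 < r. Proof. exact: lt_le_trans ltr01 r1. Qed.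
Let xr : `|x| <= r. Proof. exact: (abs_le_radius (ltW r0) e). Qed.
Let yr : `|y| <= r. Proof. by apply: (@abs_le_radius _ y x r (ltW r0)); rewrite addrC. Qed.
Let sr : `|s| <= r. Proof. by move: rs s0 => *; lra. Qed.
Let mono i j k := monomial_bound i j k xr yr sr.
Let r35 : r ^+ 3 <= r ^+ 5. Proof. by rewrite ler_weXn2l. Qed.
Let d0 : 0 < rden x y s.
Proof. by apply: lt_le_trans (rden_lower rs e); rewrite divr_gt0// exprn_gt0. Qed.

(** From r^5 <= r^6 and Q >= r^6 / 18, with 1260 = 70 * 18. *)
Let quot_le (u : R) : `|u| <= 70 * r ^+ 5 -> `|u / (r ^+ 2 * rden x y s)| <= 1260 / r ^+ 2.
Proof.
move=> ur; have r2 : 0 < r ^+ 2 by rewrite exprn_gt0.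
rewrite normrM normfV (gtr0_norm (mulr_gt0 r2 d0)) ler_pdivrMr ?mulr_gt0//.
rewrite mulrA divfK ?gt_eqF//; apply: (le_trans ur).
apply: (@le_trans _ _ (1260 * (r ^+ 6 / 18))); last first.
  by apply: ler_wpM2l; [exact: ler0n|exact: rden_lower rs e].
have : r ^+ 5 <= r ^+ 6 by rewrite ler_weXn2l.
by move=> ?; lra.
Qed.

(** In r^2 Q_x - 6 x Q the terms of degree 7, which come from r^6 / 9, cancel. The rest has degree
    at most 5 in x, y, s, all bounded by r, with absolute coefficients summing to less than 70. *)
Lemma log_x_far : `|log_x x y s - 6 * x / (x ^+ 2 + y ^+ 2)| <= 1260 / r ^+ 2.
Proof.
pose u := - 4 * x ^+ 3 - 4 * (x * y ^+ 2) - 2 / 3 * x ^+ 5 - 20 / 3 * (x ^+ 3 * y ^+ 2)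
  + 2 * (x * y ^+ 4) - 6 * (x * s ^+ 2) + 10 * (x ^+ 2 * s) - 2 * (y ^+ 2 * s)
  - 2 * (x ^+ 4 * s) - 2 * (y ^+ 4 * s) + 12 * (x ^+ 2 * y ^+ 2 * s).
have -> : log_x x y s - 6 * x / (x ^+ 2 + y ^+ 2) = u / (r ^+ 2 * rden x y s).
  have -> : u = r ^+ 2 * rden_x x y s - 6 * x * rden x y s.
    by rewrite -e /u /rden_x rdenE; field.
  by rewrite e /log_x; field; rewrite !gt_eqF.
apply: quot_le; rewrite ler_norml /u.
have := mono 3 0 0; have := mono 1 2 0; have := mono 5 0 0; have := mono 3 2 0.
have := mono 1 4 0; have := mono 1 0 2; have := mono 2 0 1; have := mono 0 2 1.
have := mono 4 0 1; have := mono 0 4 1; have := mono 2 2 1.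
rewrite !expr0 !expr1 !mulr1 !mul1r /= => *; move: r35 => ?.
apply/andP; split; lra.
Qed.

Lemma log_y_far : `|log_y x y s - 6 * y / (x ^+ 2 + y ^+ 2)| <= 1260 / r ^+ 2.
Proof.
pose u := - 4 * y ^+ 3 - 4 * (x ^+ 2 * y) - 2 / 3 * y ^+ 5 - 20 / 3 * (x ^+ 2 * y ^+ 3)
  + 2 * (x ^+ 4 * y) - 6 * (y * s ^+ 2) + 12 * (x * y * s)
  - 8 * (x ^+ 3 * y * s) + 8 * (x * y ^+ 3 * s).
have -> : log_y x y s - 6 * y / (x ^+ 2 + y ^+ 2) = u / (r ^+ 2 * rden x y s).
  have -> : u = r ^+ 2 * rden_y x y s - 6 * y * rden x y s.
    by rewrite -e /u /rden_y rdenE; field.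
  by rewrite e /log_y; field; rewrite !gt_eqF.
apply: quot_le; rewrite ler_norml /u.
have := mono 0 3 0; have := mono 2 1 0; have := mono 0 5 0; have := mono 2 3 0.
have := mono 4 1 0; have := mono 0 1 2; have := mono 1 1 1; have := mono 3 1 1.
have := mono 1 3 1.
rewrite !expr0 !expr1 !mulr1 !mul1r /= => *; move: r35 => ?.
apply/andP; split; lra.
Qed.

End Far.

(** With p = x^2 + y^2 the leading terms of p Q_x - 2 x Q cancel, and the rest is at most 10 x p Q.
    The bound is uniform in y and proportional to x, as a long side close to the axis requires. *)
Lemma log_x_near x y : 0 < x ->
  `|log_x x y 0 - 2 * x / (x ^+ 2 + y ^+ 2)| <= 10 * x.
Proof.
move=> x0; pose p := x ^+ 2 + y ^+ 2.
have p0 : 0 < p by rewrite ltr_pwDl ?sqr_ge0// exprn_gt0.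
have d0 : 0 < rden x y 0 by rewrite rden_gt0// gt_eqF.
have yp : 0 <= y ^+ 4 <= p ^+ 2.
  rewrite (exprM y 2 2) sqr_ge0 /= lerXn2r// ?nnegrE ?sqr_ge0 ?(ltW p0)//.
  by rewrite lerDr sqr_ge0.
have -> : log_x x y 0 - 2 * x / (x ^+ 2 + y ^+ 2)
    = 2 * x * (p ^+ 2 / 3 + 2 / 9 * p ^+ 3 + 4 / 3 * y ^+ 4) / (p * rden x y 0).
  have -> : 2 * x * (p ^+ 2 / 3 + 2 / 9 * p ^+ 3 + 4 / 3 * y ^+ 4)
      = p * rden_x x y 0 - 2 * x * rden x y 0.
    by rewrite /p /rden_x rdenE; field.
  by rewrite -/p /log_x; field; rewrite !gt_eqF.
have p2 : 0 <= p ^+ 2 by rewrite sqr_ge0.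
have p3 : 0 <= p ^+ 3 by rewrite exprn_ge0// ltW.
rewrite ger0_norm; last first.
  by rewrite divr_ge0 ?mulr_ge0 ?(ltW p0) ?(ltW d0) ?(ltW x0)//; lra.
rewrite ler_pdivrMr ?mulr_gt0//.
rewrite (_ : 10 * x * (p * rden x y 0) = 2 * x * (5 * (p * rden x y 0))); last by ring.
apply: ler_wpM2l; first by rewrite mulr_ge0// ltW.
have -> : p * rden x y 0 = p ^+ 2 + p ^+ 3 / 3 + p ^+ 4 / 9 + 4 / 3 * (p * (x * y) ^+ 2).
  by rewrite rdenE /p; field.
have : 0 <= p * (x * y) ^+ 2 by rewrite mulr_ge0 ?sqr_ge0// ltW.
have : 0 <= p ^+ 4 by rewrite exprn_ge0// ltW.
by move=> *; lra.
Qed.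

(** The derivative is the flux density of k log r through a line at distance n; the primitive is k
    times the angle subtended. *)
Lemma is_derive_atan_scale (k n y : R) : n != 0 ->
  is_derive y 1 (fun y => k * atan (y / n)) (k * n / (n ^+ 2 + y ^+ 2)).
Proof.
move=> n0.
have h : is_derive y 1 (fun y => y / n) n^-1.
  by apply: is_derive_eq; rewrite /GRing.scale /= mulr1 mulr0 add0r.
have h2 := @is_derive1_comp _ atan (fun y => y / n) y _ _ (is_derive1_atan (y / n)) h.
apply: is_derive_eq (is_derive1M (is_derive_cst k y 1) h2) _.
have n2 : n ^+ 2 + y ^+ 2 != 0 by rewrite gt_eqF// ltr_pwDl ?sqr_ge0// exprn_even_gt0.
have n3 : 1 + (y / n) ^+ 2 != 0 by rewrite gt_eqF// ltr_pwDl ?sqr_ge0.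
rewrite mulr0 addr0 -mulrA; congr (_ * _).
have -> : 1 + (y / n) ^+ 2 = (n ^+ 2 + y ^+ 2) / n ^+ 2 by field.
by field; rewrite n0 n2.
Qed.

Lemma continuous_atan_kernel (k n y : R) : n != 0 ->
  {for y, continuous (fun y => k * n / (n ^+ 2 + y ^+ 2))}.
Proof.
move=> n0; apply: continuousM; first exact: cst_continuous.
apply: continuousV; first by rewrite gt_eqF// ltr_pwDl ?sqr_ge0// exprn_even_gt0.
by apply: continuousD; [exact: cst_continuous|exact: exprn_continuous].
Qed.

End Estimates.

(** * Integrals over large boxes *)

Section BoxIntegrals.
Variable R : realType.
Local Notation TR := (measurableTypeR R).
Local Notation mu := (@lebesgue_measure R).
Local Notation mu2 := ((@lebesgue_measure R) \x (@lebesgue_measure R))%E.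
Implicit Types x y s N : R.

(** Along the sides of a square the radius varies but is at least N, so the errors are restated in
    terms of N. *)
Lemma far_radius : exists2 K : R, 0 <= K & forall x y s N,
  1 + 72 * `|s| <= N -> N ^+ 2 <= x ^+ 2 + y ^+ 2 ->
  `|log_x x y s - 6 * x / (x ^+ 2 + y ^+ 2)| <= K / N ^+ 2 /\
  `|log_y x y s - 6 * y / (x ^+ 2 + y ^+ 2)| <= K / N ^+ 2.
Proof.
exists 1260 => [|x y s N]; first exact: ler0n.
move=> sN Nxy; have s0 := normr_ge0 s.
have N0 : 0 < N by lra.
pose r := Num.sqrt (x ^+ 2 + y ^+ 2).
have rE : x ^+ 2 + y ^+ 2 = r ^+ 2 by rewrite /r sqr_sqrtr// addr_ge0 ?sqr_ge0.
have r0 : 0 <= r by exact: sqrtr_ge0.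
have Nr : N <= r by rewrite -(@ler_pXn2r _ 2)// ?nnegrE ?(ltW N0)// -rE.
have rs : 1 + 72 * `|s| <= r by lra.
have h : 1260 / r ^+ 2 <= 1260 / N ^+ 2.
  apply: ler_wpM2l; first exact: ler0n.
  by rewrite lef_pV2 -?rE// posrE ?rE exprn_gt0// (lt_le_trans N0).
by split; apply: le_trans h; [exact: log_x_far|exact: log_y_far].
Qed.

(** Each pair of opposite sides has flux close to 12 (pi / 4 + pi / 4) = 6 pi, and a quarter of the
    total 12 pi is 3 pi. The errors 2 K / N^2 over two lengths 2 N, divided by 4, give 2 K / N. *)
Lemma box_integral : exists2 K : R, 0 <= K & forall s N, s != 0 -> 1 + 72 * `|s| <= N ->
  exists2 I, (\int[mu2]_(q in rect (- N) N (- N) N)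
      ((rnum q.1 q.2 s / rden q.1 q.2 s) ^+ 2)%:E = I%:E)%E &
    `|I - 3 * pi| <= K / N.
Proof.
have [K K0 far] := far_radius; exists (2 * K) => [|s N s0 sN].
  exact: mulr_ge0.
have s1 := normr_ge0 s.
have N0 : 0 < N by lra.
have NN : - N < N by lra.
have NN2 : N ^+ 2 <= (- N) ^+ 2 by rewrite sqrrN.
have d0 x y : - N <= x <= N -> - N <= y <= N -> rden x y s != 0.
  by move=> _ _; rewrite gt_eqF// rden_gt0// s0 !orbT.
pose g y := 12 * N / (N ^+ 2 + y ^+ 2).
pose G y := 12 * atan (y / N).
have dG y : - N <= y <= N -> is_derive y 1 G (g y).
  by move=> _; apply: is_derive_atan_scale; rewrite gt_eqF.
have cg y : - N <= y <= N -> {for y, continuous g}.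
  by move=> _; apply: continuous_atan_kernel; rewrite gt_eqF.
pose e := 2 * (K / N ^+ 2).
have e0 : 0 <= e by rewrite mulr_ge0// divr_ge0 ?sqr_ge0.
have e2 : e = K / N ^+ 2 + K / N ^+ 2 by rewrite /e mulrDl mul1r.
have h1 y : - N <= y <= N -> `|log_x N y s - log_x (- N) y s - g y| <= e.
  move=> _.
  have [a _] := far N y s N sN (ler_wpDr (sqr_ge0 y) (lexx _)).
  have [b _] := far (- N) y s N sN (ler_wpDr (sqr_ge0 y) NN2).
  rewrite sqrrN in b.
  rewrite [X in `|X|](_ : _ = (log_x N y s - 6 * N / (N ^+ 2 + y ^+ 2))
    - (log_x (- N) y s - 6 * - N / (N ^+ 2 + y ^+ 2))); last first.
    by rewrite /g mulrN; move: (N ^+ 2 + y ^+ 2)^-1 => *; ring.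
  by rewrite e2 (le_trans (ler_normB _ _))// lerD.
have h2 x : - N <= x <= N -> `|log_y x N s - log_y x (- N) s - g x| <= e.
  move=> _.
  have [_ a] := far x N s N sN (ler_wpDl (sqr_ge0 x) (lexx _)).
  have [_ b] := far x (- N) s N sN (ler_wpDl (sqr_ge0 x) NN2).
  rewrite sqrrN in b.
  rewrite [X in `|X|](_ : _ = (log_y x N s - 6 * N / (x ^+ 2 + N ^+ 2))
    - (log_y x (- N) s - 6 * - N / (x ^+ 2 + N ^+ 2))); last first.
    by rewrite /g mulrN (addrC (N ^+ 2)); move: (x ^+ 2 + N ^+ 2)^-1 => *; ring.
  by rewrite e2 (le_trans (ler_normB _ _))// lerD.
have [I IE IH] := flux_close NN NN d0 e0 e0 dG cg h1 dG cg h2.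
exists I => //.
have N0' : N != 0 by rewrite gt_eqF.
have GN : G N - G (- N) = 6 * pi.
  by rewrite /G mulNr atanN divff// atan1; field.
move: IH; rewrite GN.
rewrite (_ : e * (N - - N) + e * (N - - N) = 4 * (2 * K / N)); last by rewrite /e; field.
rewrite (_ : 4 * I - (6 * pi + 6 * pi) = 4 * (I - 3 * pi)); last by ring.
by rewrite normrM ger0_norm// ler_pM2l.
Qed.

Lemma log_x_odd x y : log_x (- x) y 0 = - log_x x y 0.
Proof.
rewrite /log_x (_ : rden (- x) y 0 = rden x y 0); last by rewrite /rden; field.
by rewrite -mulNr; congr (_ / _); rewrite /rden_x; field.
Qed.

(* For [s = 0] the square is cut into two rectangles avoiding the strip
   [|x| < N^-2] around the singularity. *)
Lemma half_box_integrals : exists2 K : R, 0 <= K & forall N, 2 <= N ->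
  exists I J, [/\
    (\int[mu2]_(q in rect (N ^- 2) N (- N) N)
      ((rnum q.1 q.2 0 / rden q.1 q.2 0) ^+ 2)%:E = I%:E)%E,
    (\int[mu2]_(q in rect (- N) (- N ^- 2) (- N) N)
      ((rnum q.1 q.2 0 / rden q.1 q.2 0) ^+ 2)%:E = J%:E)%E &
    `|I + J - (3 * pi - 2 * atan (N ^+ 3) - 6 * atan (N ^- 3))| <= K / N].
Proof.
have [K K0 far] := far_radius; exists (2 * K + 10) => [|N N2].
  by rewrite addr_ge0// mulr_ge0.
have N0 : 0 < N by lra.
have N1 : 1 <= N by lra.
have N0' : N != 0 by rewrite gt_eqF.
have sN : 1 + 72 * `|0 : R| <= N by rewrite normr0 mulr0 addr0.
have NN : - N < N by lra.
have NN2 : N ^+ 2 <= (- N) ^+ 2 by rewrite sqrrN.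
(* With this d the inner error 10 d over a length 2 N is 20 / N, while N / d = N^3 still tends to
   infinity. *)
pose d : R := N ^- 2.
have d0 : 0 < d by rewrite invr_gt0 exprn_gt0.
have dN : d < N.
  apply: (@lt_le_trans _ _ 1); last exact: N1.
  by rewrite /d invf_lt1 ?exprn_gt0// exprn_egt1//; lra.
have nz x y : x != 0 -> rden x y 0 != 0.
  by move=> x0; rewrite gt_eqF// rden_gt0// x0.
pose e1 := K / N ^+ 2 + 10 * d.
pose e2 := 2 * (K / N ^+ 2).
have e2E : e2 = K / N ^+ 2 + K / N ^+ 2 by rewrite /e2 mulrDl mul1r.
have KN : 0 <= K / N ^+ 2 by rewrite divr_ge0 ?sqr_ge0.
have e10 : 0 <= e1 by rewrite addr_ge0// mulr_ge0// ltW.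
have e20 : 0 <= e2 by rewrite mulr_ge0.
(* Outer side modelled by 6 log r, inner side by 2 log r, with opposite outward normals. *)
pose g1 y := 6 * N / (N ^+ 2 + y ^+ 2) + - (2 * d / (d ^+ 2 + y ^+ 2)).
pose G1 y := 6 * atan (y / N) + - (2 * atan (y / d)).
pose g2 y := 12 * N / (N ^+ 2 + y ^+ 2).
pose G2 y := 12 * atan (y / N).
have dG1 y : - N <= y <= N -> is_derive y 1 G1 (g1 y).
  move=> _; apply: is_derive1D; last apply: is_derive1N.
    by apply: is_derive_atan_scale.
  by apply: is_derive_atan_scale; rewrite gt_eqF.
have cg1 y : - N <= y <= N -> {for y, continuous g1}.
  move=> _; apply: continuousD; first exact: continuous_atan_kernel.
  by apply: continuousN; apply: continuous_atan_kernel; rewrite gt_eqF.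
have h1 y : - N <= y <= N -> `|log_x N y 0 - log_x d y 0 - g1 y| <= e1.
  move=> _; have [a _] := far N y 0 N sN (ler_wpDr (sqr_ge0 y) (lexx _)).
  have b := log_x_near y d0.
  rewrite [X in `|X|](_ : _ = (log_x N y 0 - 6 * N / (N ^+ 2 + y ^+ 2))
    - (log_x d y 0 - 2 * d / (d ^+ 2 + y ^+ 2))); last first.
    by rewrite /g1; move: (N ^+ 2 + y ^+ 2)^-1 (d ^+ 2 + y ^+ 2)^-1 => *; ring.
  by rewrite (le_trans (ler_normB _ _))// lerD.
have h2 x : `|log_y x N 0 - log_y x (- N) 0 - g2 x| <= e2.
  have [_ a] := far x N 0 N sN (ler_wpDl (sqr_ge0 x) (lexx _)).
  have [_ b] := far x (- N) 0 N sN (ler_wpDl (sqr_ge0 x) NN2).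
  rewrite sqrrN in b.
  rewrite [X in `|X|](_ : _ = (log_y x N 0 - 6 * N / (x ^+ 2 + N ^+ 2))
    - (log_y x (- N) 0 - 6 * - N / (x ^+ 2 + N ^+ 2))); last first.
    by rewrite /g2 mulrN (addrC (N ^+ 2)); move: (x ^+ 2 + N ^+ 2)^-1 => *; ring.
  by rewrite e2E (le_trans (ler_normB _ _))// lerD.
have dG2 y : is_derive y 1 G2 (g2 y) by exact: is_derive_atan_scale.
have cg2 y : {for y, continuous g2} by exact: continuous_atan_kernel.
have nz1 x y : d <= x <= N -> - N <= y <= N -> rden x y 0 != 0.
  by move=> /andP[dx _] _; apply: nz; rewrite gt_eqF// (lt_le_trans d0).
have nz2 x y : - N <= x <= - d -> - N <= y <= N -> rden x y 0 != 0.
  by move=> /andP[_ xd] _; apply: nz; rewrite lt_eqF// (le_lt_trans xd)// oppr_lt0.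
have NdN : - N < - d by rewrite ltrN2.
have h1' y : - N <= y <= N -> `|log_x (- d) y 0 - log_x (- N) y 0 - g1 y| <= e1.
  by move=> /h1; rewrite !log_x_odd opprK [- _ + _]addrC.
have [I IE IH] := flux_close dN NN nz1 e10 e20 dG1 cg1 h1
  (fun x _ => dG2 x) (fun x _ => cg2 x) (fun x _ => h2 x).
have [J JE JH] := flux_close NdN NN nz2 e10 e20 dG1 cg1 h1'
  (fun x _ => dG2 x) (fun x _ => cg2 x) (fun x _ => h2 x).
exists I, J; split => //.
have d0' : d != 0 by rewrite gt_eqF.
have EG1 : G1 N - G1 (- N) = 3 * pi - 4 * atan (N ^+ 3).
  have e3 : N / d = N ^+ 3 by rewrite /d invrK -exprS.
  by rewrite /G1 !mulNr !atanN divff// atan1 e3; field.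
have EG2 : G2 N - G2 d = 3 * pi - 12 * atan (N ^- 3).
  have e3 : d / N = N ^- 3 by rewrite /d; field.
  by rewrite /G2 divff// atan1 e3; field.
have EG2' : G2 (- d) - G2 (- N) = 3 * pi - 12 * atan (N ^- 3).
  by rewrite -EG2 /G2 !mulNr !atanN; ring.
rewrite EG1 EG2 in IH; rewrite EG1 EG2' in JH.
(* Each half gives 4 times its integral up to this error, so adding the halves and dividing by 4
   leaves (2 K + 10) / N. *)
have eK : e1 * (N - - N) + e2 * (N - d) <= 2 * ((2 * K + 10) / N).
  have -> : 2 * ((2 * K + 10) / N) = e1 * (N - - N) + e2 * N.
    by rewrite /e1 /e2 /d; field.
  by rewrite lerD2l ler_wpM2l// gerBl ltW.
have eK' : e1 * (N - - N) + e2 * (- d - - N) <= 2 * ((2 * K + 10) / N).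
  by rewrite (_ : - d - - N = N - d)//; ring.
have := ler_normD (4 * I - (3 * pi - 4 * atan (N ^+ 3) + (3 * pi - 12 * atan (N ^- 3))))
  (4 * J - (3 * pi - 4 * atan (N ^+ 3) + (3 * pi - 12 * atan (N ^- 3)))).
rewrite [X in `|X| <= _ -> _](_ : _ = 4 * (I + J
  - (3 * pi - 2 * atan (N ^+ 3) - 6 * atan (N ^- 3)))); last by ring.
rewrite normrM ger0_norm//.
by move: IH JH eK eK'; move: ((2 * K + 10) / N) => *; lra.
Qed.

End BoxIntegrals.

(** * Passage to the whole plane *)

Section TotalIntegral.
Variable R : realType.
Local Notation TR := (measurableTypeR R).
Local Notation mu := (@lebesgue_measure R).
Local Notation mu2 := ((@lebesgue_measure R) \x (@lebesgue_measure R))%E.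

(** Monotone convergence equates the integral over the union with the limit of those over [F n], and
    the error bound identifies that limit. *)
Lemma integral_exhaustion (F : nat -> set (TR * TR)) (f : TR * TR -> R) (c : nat -> R) (K l : R) :
  nondecreasing_seq F -> (forall n, measurable (F n)) -> measurable_fun setT f ->
  (forall q, 0 <= f q) -> 0 <= K ->
  (forall n, exists2 J, (\int[mu2]_(q in F n) (f q)%:E = J%:E)%E & `|J - c n| <= K / n.+1%:R) ->
  c n @[n --> \oo] --> l ->
  (\int[mu2]_(q in \bigcup_n F n) (f q)%:E = l%:E)%E.
Proof.
move=> ndF mF mf f0 K0 hJ cl.
have mFf n : measurable_fun (F n) (EFin \o f).
  by apply/measurable_EFinP; exact: measurable_funS mf.
have F0 n q : F n q -> (0 <= (EFin \o f) q)%E by move=> _; rewrite lee_fin.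
have h1 := @ge0_nondecreasing_set_cvg_integral _ _ _ F (EFin \o f) mu2 ndF mF mFf F0.
pose J n := fine (\int[mu2]_(q in F n) (f q)%:E)%E.
have JE n : (\int[mu2]_(q in F n) (f q)%:E = (J n)%:E)%E.
  by have [I E _] := hJ n; rewrite /J E.
have Jc n : `|J n - c n| <= K * n.+1%:R^-1.
  by have [I E h] := hJ n; rewrite /J E.
have Jl : J n @[n --> \oo] --> l.
  have hK : K * harmonic n @[n --> \oo] --> (0 : R).
    by rewrite -[X in _ --> X](mulr0 K); apply: cvgMr; exact: cvg_harmonic.
  have lo : c n - K * harmonic n @[n --> \oo] --> l.
    by rewrite -[X in _ --> X]subr0; exact: cvgB.
  have hi : c n + K * harmonic n @[n --> \oo] --> l.
    by rewrite -[X in _ --> X]addr0; exact: cvgD.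
  apply: squeeze_cvgr lo hi; apply: nearW => n.
  have := Jc n; rewrite -[n.+1%:R^-1]/(harmonic n) ler_norml.
  by move: (harmonic n) => h /andP[? ?]; apply/andP; split; lra.
have h2 : (\int[mu2]_(q in F n) (f q)%:E)%E @[n --> \oo] --> l%:E.
  by under eq_fun do rewrite JE; apply: cvg_EFin => //; exact: nearW.
exact: (cvg_unique _ h1 h2).
Qed.

Local Notation dens s := (fun q : TR * TR => (rnum q.1 q.2 s / rden q.1 q.2 s) ^+ 2).

Lemma nondecreasing_rect (N : nat -> R) : nondecreasing_seq N ->
  nondecreasing_seq (fun n => rect (- N n) (N n) (- N n) (N n)).
Proof.
move=> ndN n m nm; apply/subsetPset => -[x y] [/=]; rewrite !in_itv /= => /andP[? ?] /andP[? ?].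
have ? := ndN _ _ nm; split; rewrite /= in_itv /=; apply/andP; split; lra.
Qed.

Lemma integral_dens_neq0 s : s != 0 -> (\int[mu2]_(q in setT) (dens s q)%:E = (3 * pi)%:E)%E.
Proof.
move=> s0; have [K K0 box] := box_integral R; have s1 := normr_ge0 s.
pose N n : R := n%:R + 1 + 72 * `|s|.
have -> : [set: TR * TR] = \bigcup_n rect (- N n) (N n) (- N n) (N n).
  apply/seteqP; split => // -[x y] _; exists (Num.bound (`|x| + `|y|)) => //.
  have b := archi_boundP (addr_ge0 (normr_ge0 x) (normr_ge0 y)).
  have xN : `|x| <= N (Num.bound (`|x| + `|y|)) by rewrite /N; have := normr_ge0 y; lra.
  have yN : `|y| <= N (Num.bound (`|x| + `|y|)) by rewrite /N; have := normr_ge0 x; lra.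
  by split; rewrite /= in_itv /= -ler_norml.
apply: (@integral_exhaustion _ _ (fun=> 3 * pi) K).
- apply: nondecreasing_rect => n m nm; rewrite /N.
  by have : (n%:R : R) <= m%:R by [rewrite ler_nat]; lra.
- by move=> n; exact: measurable_rect.
- exact: measurable_Usqr.
- by move=> q; exact: sqr_ge0.
- exact: K0.
- move=> n; have [|I IE IH] := box s (N n) s0; first by rewrite /N; have := ler0n R n; lra.
  exists I => //; apply: (le_trans IH); apply: ler_wpM2l => //.
  by rewrite lef_pV2 ?posrE /N -?natr1; have := ler0n R n; lra.
- exact: cvg_cst.
Qed.

Lemma integral_dens_eq0 : (\int[mu2]_(q in setT) (dens 0 q)%:E = (2 * pi)%:E)%E.
Proof.
have [K K0 box] := half_box_integrals R.
pose N n : R := n.+2%:R.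
have N2 n : 2 <= N n by rewrite /N ler_nat.
have N0 n : 0 < N n by rewrite /N.
(* The half boxes exhaust only the complement of the line x = 0, which is a null set. *)
pose Z : set (TR * TR) := [set 0] `*` setT.
have mZ : measurable Z by apply: measurableX => //; exact: measurable_set1.
have Z0 : mu2 Z = 0%E.
  transitivity (mu [set 0%R : TR] * mu setT)%E; last by rewrite lebesgue_measure_set1 mul0e.
  by apply: product_measure1E => //; exact: measurable_set1.
have md := measurable_Usqr (0 : R).
rewrite (@ge0_negligible_integral _ _ _ _ _ Z)//; last 2 first.
- exact/measurable_EFinP.
- by move=> q _; rewrite lee_fin sqr_ge0.
pose F n := rect (N n ^- 2) (N n) (- N n) (N n) `|` rect (- N n) (- N n ^- 2) (- N n) (N n).
have d0 n : 0 < N n ^- 2 by rewrite invr_gt0 exprn_gt0.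
have -> : [set: TR * TR] `\` Z = \bigcup_n F n.
  apply/seteqP; split => [[x y] [_ Zq]|[x y] [n _ Fq]]; last first.
    split => // -[/= x0 _]; case: Fq => -[/=]; rewrite x0 in_itv /= => /andP[h1 h2] _.
      by have := d0 n; rewrite ltNge h1.
    by have := d0 n; rewrite ltNge -oppr_ge0 h2.
  have x0 : 0 < `|x| by rewrite normr_gt0; apply/eqP => x0; apply: Zq; split.
  pose b := Num.bound (`|x|^-1 + `|x| + `|y|).
  have bN : `|x|^-1 + `|x| + `|y| <= N b.
    apply: ltW; apply: (@lt_le_trans _ _ b%:R); last by rewrite /N ler_nat; lia.
    by apply: archi_boundP; rewrite !addr_ge0 ?invr_ge0.
  have xV : 0 <= `|x|^-1 by rewrite invr_ge0.
  have xN : `|x| <= N b by have := normr_ge0 y; lra.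
  have yN : `|y| <= N b by lra.
  (* Since 1 / |x| <= N and N >= 1, also 1 / |x| <= N^2. *)
  have dx : N b ^- 2 <= `|x|.
    rewrite -[leRHS]invrK lef_pV2 ?posrE ?invr_gt0 ?exprn_gt0//.
    apply: (@le_trans _ _ (N b)); first by have := normr_ge0 y; lra.
    by rewrite ler_eXnr//; have := N2 b; lra.
  exists b => //; case: (ltrP x 0) => hx.
    right; split; rewrite /= in_itv /=; last by rewrite -ler_norml.
    by move: xN dx; rewrite ltr0_norm// => h1 h2; rewrite lerNl h1 lerNr.
  left; split; rewrite /= in_itv /=; last by rewrite -ler_norml.
  by move: xN dx; rewrite ger0_norm// => h1 ->.
pose c n := 3 * pi - 2 * atan (N n ^+ 3) - 6 * atan (N n ^- 3).
apply: (@integral_exhaustion _ _ c K).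
- move=> n m nm; apply/subsetPset; have NN : N n <= N m by rewrite /N ler_nat !ltnS.
  have dd : N m ^- 2 <= N n ^- 2.
    by rewrite lef_pV2 ?posrE ?exprn_gt0// lerXn2r// nnegrE ltW.
  rewrite /F; move: NN dd; move: (N n ^- 2) (N m ^- 2) (N n) (N m) => u v a b ? ?.
  by apply: setUSS => -[x y] [/=]; rewrite !in_itv /= => /andP[? ?] /andP[? ?];
    split; rewrite /= in_itv /=; apply/andP; split; lra.
- by move=> n; apply: measurableU; exact: measurable_rect.
- exact: md.
- by move=> q; exact: sqr_ge0.
- exact: K0.
- move=> n; have [I [J [IE JE IJ]]] := box (N n) (N2 n).
  exists (I + J).
    rewrite ge0_integral_setU//=.
    + by rewrite EFinD -IE -JE.
    + exact: measurable_rect.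
    + exact: measurable_rect.
    + by apply/measurable_EFinP; exact: measurable_funS md.
    + by move=> q _; rewrite lee_fin sqr_ge0.
    + apply/disj_setPS => -[x y] [[/= + _] [/= + _]]; rewrite !in_itv /= => /andP[h1 _] /andP[_ h2].
      by move: (le_trans h1 h2) (d0 n); move: (N n ^- 2) => u ? ?; lra.
  apply: (le_trans IJ); apply: ler_wpM2l => //.
  by rewrite lef_pV2 ?posrE /N ?ltr0n// ler_nat.
(* The inner flux 2 atan (N^3) tends to pi, the loss due to the singular point; the last term
   accounts for the missing width of the horizontal sides and vanishes. *)
- rewrite /c (_ : 2 * pi = 3 * pi - 2 * (pi / 2) - 6 * atan 0); last by rewrite atan0; field.
  have Nn n : n%:R <= N n by rewrite /N ler_nat; lia.
  have N3 n : N n <= N n ^+ 3 by rewrite ler_eXnr//; have := N2 n; lra.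
  have N3y : N n ^+ 3 @[n --> \oo] --> +oo.
    apply: (ger_cvgy (f := fun n => n%:R : R)); last exact: cvgr_idn.
    by apply: nearW => n; exact: le_trans (Nn n) (N3 n).
  have N3_gt0 : \forall n \near \oo, 0 < N n ^+ 3.
    by apply: nearW => n; rewrite exprn_gt0.
  have N3V : N n ^- 3 @[n --> \oo] --> (0 : R).
    exact: (gtr0_cvgV0 N3_gt0).2 N3y.
  have l1 : atan (N n ^+ 3) @[n --> \oo] --> pi / 2 := cvg_comp _ _ N3y (@cvgy_atan R).
  have l2 : atan (N n ^- 3) @[n --> \oo] --> atan 0 := cvg_comp _ _ N3V (@continuous_atan R 0).
  apply: cvgB; last by apply: cvgMr.
  by apply: cvgB; [exact: cvg_cst|apply: cvgMr].
Qed.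

Variable C : R.

Lemma integral_Ut_sqr t :
  (\int[mu2]_(q in setT) ((complex.Re `|Ut C (q.1, q.2, t)|) ^+ 2)%:E
   = (if t == C then 2 * pi else 3 * pi)%:E)%E.
Proof.
transitivity (\int[mu2]_(q in setT) (dens (C - t) q)%:E)%E.
  apply: eq_integral => q _; congr (_%:E).
  by rewrite UtE normc_real /= real_normK// num_real.
case: eqP => [->|/eqP tC]; first by rewrite subrr integral_dens_eq0.
by rewrite integral_dens_neq0// subr_eq0 eq_sym.
Qed.

End TotalIntegral.

Lemma analytic_atc_Ut_Vt (R : realType) (C : R) (p : R * R * R) :
  p != sing C -> analytic_atc (Ut C) p /\ analytic_atc (Vt C) p.
Proof.
move=> np; have oA := @open_neq_sing R C.
have [rU iU] := cratfun_Ut C; have [rV iV] := cratfun_Vt C.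
by split; split; [exact: ratfun_analytic rU oA np | exact: ratfun_analytic iU oA np
                 | exact: ratfun_analytic rV oA np | exact: ratfun_analytic iV oA np].
Qed.

Theorem theorem2 (R : realType) (C : R) (C_gt0 : 0 < C) :
  (* 1 *)
  mNV_solution [set p | p != sing C] (Ut C) (Vt C)
  (* 2 *)
  /\ (forall t : R,
        quadratic_decay (fun x y => Ut C (x, y, t)) /\
        quadratic_decay (fun x y => Vt C (x, y, t)))
  (* 3 *)
  /\ (forall x y t : R, t != C ->
        analytic_atc (Ut C) (x, y, t) /\ analytic_atc (Vt C) (x, y, t))
  (* 4 *)
  /\ [/\ forall p : R * R * R, p != sing C ->
           analytic_atc (Ut C) p /\ analytic_atc (Vt C) p,
         ~ extends_continuously (Ut C) (sing C),
         ~ extends_continuously (Vt C) (sing C),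
         forall p : R * R * R, denom C p = 0 <-> p = sing C
       & forall phi : R,
           (Ut C (r * cos phi, r * sin phi, C) : R[i]^o) @[r --> 0^'+]
             --> ((- cos (2 * phi))%:C : R[i]^o)]
  (* 5 *)
  /\ (forall t : R,
        (\int[(@lebesgue_measure R \x @lebesgue_measure R)%E]_(q in setT)
           ((complex.Re `|Ut C (q.1, q.2, t)|) ^+ 2)%:E)%E
        = (if t == C then 2 * pi else 3 * pi)%:E).
Proof.
split; first exact: mNV_solution_Ut_Vt.
split; first by move=> t; split; [exact: decay_Ut|exact: decay_Vt].
split.
  move=> x y t tC; apply: analytic_atc_Ut_Vt.
  by apply: contra tC => /eqP[_ _ ->].
split; last exact: integral_Ut_sqr.
split; [exact: analytic_atc_Ut_Vt | exact: not_extends_Ut | exact: not_extends_Vt | |].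
  by move=> p; exact: denom_eq0.
exact: Ut_ray.
Qed.
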